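(* Let $b\ge3$ be an integer and let $D=\{kd+a:\ k=0,\dots,l-1\}$ for some integers $a\ge0$, $d\ge1$, $l\ge2$. Assume $D$ is a proper subset of $\{0,\dots,b-1\}$, and let $\nu$ be the natural missing-digit measure on $K_{b,D}$. Then \[ \dim_{\mathrm H}(\nu)\ge\hat\kappa_1(\nu)\ge\dim_{\mathrm H}(\nu)-\frac{\log(4+\log 2l)}{\log b}. \]
   Context: The natural measure $\nu$ on $K_{b,D}$ is the distribution of $\sum_{i\ge1}D_ib^{-i}$ with $D_1,D_2,\dots$ i.i.d. uniform on $D$; $\dim_{\mathrm H}(\nu)$ is the Hausdorff dimension of $\mathrm{supp}(\nu)=K_{b,D}$ (the set of $x\in[0,1]$ having a base-$b$ expansion with digits in $D$). Write $e(x)=e^{2\pi ix}$, $\hat\nu(\xi)=\int_0^1e(-\xi x)\,d\nu(x)$ for $\xi\in\mathbb Z$, and $\hat\kappa_1(\nu)=\sup\{s\ge0:\ \exists C_s\text{ with }\sum_{\xi=0}^Q|\hat\nu(\xi)|\le C_sQ^{1-s}\text{ for all }Q\ge1\}$. $\log$ is the natural logarithm. *)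

(* Defs.v *)
From HB Require Import structures.
From mathcomp Require Import all_boot all_order all_algebra.
From mathcomp Require Import finmap.
From mathcomp Require Import all_classical all_reals all_analysis.
From mathcomp Require Import measurable_realfun complex.

Set Implicit Arguments.
Unset Strict Implicit.
Unset Printing Implicit Defensive.

Import Order.TTheory GRing.Theory Num.Theory.
Import numFieldNormedType.Exports.

Local Open Scope classical_set_scope.
Local Open Scope ring_scope.

Section hausdorff_dimension.
Context {R : realType}.
Implicit Types (A : set R) (s delta : R).
Local Open Scope ereal_scope.

Definition diam A : \bar R :=
  ereal_sup [set `|xy.1 - xy.2|%:E | xy in A `*` A].

(* As 0 `^ 0 = 1, a nonempty set has 0-weight at least 1; the empty set must
   be singled out, since diam set0 = -oo. *)
Definition diam_pow s A : \bar R := if A == set0 then 0 else diam A `^ s.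

Definition hausdorff_premeasure s delta A : \bar R :=
  ereal_inf [set \sum_(0 <= i <oo) diam_pow s (U i) |
    U in [set U : (set R)^nat |
      A `<=` \bigcup_i U i /\ forall i, diam (U i) <= delta%:E]].

Definition hausdorff_measure s A : \bar R :=
  ereal_sup [set hausdorff_premeasure s delta A |
    delta in [set delta : R | (0 < delta)%R]].

Definition hausdorff_dim A : \bar R :=
  ereal_inf [set s%:E |
    s in [set s : R | (0 <= s)%R /\ hausdorff_measure s A = 0]].

End hausdorff_dimension.

Section measures_on_R.
Context {R : realType}.
Implicit Types (mu : set R -> \bar R).

Definition msupport mu : set R :=
  [set x | forall U : set R, open U -> U x -> (0 < mu U)%E].

Definition dimH mu : \bar R := hausdorff_dim (msupport mu).

Definition cexp2pi (x : R) : R[i] :=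
  (cos (2 * pi * x) +i* sin (2 * pi * x))%C.

Definition fourier (nu : {measure set R -> \bar R}) (xi : int) : R[i] :=
  let f x := cexp2pi (- (xi%:~R * x)) in
  ((\int[nu]_(x in `[0, 1]) complex.Re (f x))%R +i*
   (\int[nu]_(x in `[0, 1]) complex.Im (f x))%R)%C.

Definition kappa1 (nu : {measure set R -> \bar R}) : \bar R :=
  ereal_sup [set s%:E | s in [set s : R | 0 <= s /\
    exists C : R, forall Q : nat, (1 <= Q)%N ->
      \sum_(0 <= xi < Q.+1) Normc.normc (fourier nu xi%:Z)
        <= C * Q%:R `^ (1 - s)]].

End measures_on_R.

Section digits.
Context {R : realType}.

(* u i is the coefficient of b ^- (i + 1). *)
Definition digit_sum (b : nat) (u : nat -> nat) : R :=
  limn (series (fun i => (u i)%:R / b%:R ^+ i.+1 : R)).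

Definition missing_digit_set (b : nat) (D : {fset nat}) : set R :=
  [set x | 0 <= x <= 1 /\
    exists u : nat -> nat, (forall i, u i \in D) /\ x = digit_sum b u].

End digits.

Definition arith_digits (a d l : nat) : {fset nat} :=
  [fset (k * d + a)%N | k in iota 0 l]%fset.

Section random_digits.
Context {R : realType} {disp : measure_display} {T : measurableType disp}.
Variable P : probability T R.
Implicit Types (X : nat -> {RV P >-> nat}).

Definition uniform_on (D : {fset nat}) (Y : {RV P >-> nat}) :=
  forall k : nat, P (Y @^-1` [set k]) =
    (if k \in D then (#|` D|%fset%:R)^-1 else 0)%:E.

Definition mutually_independent X :=
  forall (J : {fset nat}) (B : nat -> set nat),
    P (\bigcap_(i in [set` J]) (X i @^-1` B i)) =
    (\prod_(i <- J) P (X i @^-1` B i))%E.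

Definition random_digit_sum (b : nat) X : T -> R :=
  fun t => digit_sum b (fun i => X i t).

Lemma measurable_random_digit_sum b X :
  measurable_fun setT (random_digit_sum b X).
Proof.
set h := fun i t => ((X i t)%:R / b%:R ^+ i.+1 : R).
have h0 i t : 0 <= h i t by rewrite divr_ge0// exprn_ge0.
pose s (t : T) : \bar R := (\sum_(0 <= i <oo) (h i t)%:E)%E.
have ms : measurable_fun [set: T] s.
  rewrite (_ : s = fun t => (\sum_(i <oo | i \in predT) (h i t)%:E)%E)//.
  apply: ge0_emeasurable_sum => [k t _ _|k _]; first by rewrite lee_fin.
  apply/measurable_EFinP.
  rewrite (_ : h k = (fun n : nat => n%:R / b%:R ^+ k.+1 : R) \o X k)//.
  exact: measurableT_comp.
have sE t : s t = limn (EFin \o series (h ^~ t)).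
  by congr (limn _); apply/funext => n; rewrite /= /series/= sumEFin.
rewrite (_ : random_digit_sum b X = fine \o s); first exact: measurableT_comp.
apply/funext => t /=; rewrite sE /random_digit_sum /digit_sum.
have nd : nondecreasing_seq (series (h ^~ t)).
  by apply/nondecreasing_seqP => n; rewrite /series/= big_nat_recr//= lerDl.
have [cv|dv] := pselect (cvgn (series (h ^~ t))); first by rewrite EFin_lim.
rewrite [LHS]dvgP//.
have /cvgeryP/cvg_lim -> // := nondecreasing_dvgn_lt nd dv.
Qed.

HB.instance Definition _ b X :=
  isMeasurableFun.Build _ _ T R (random_digit_sum b X)
    (measurable_random_digit_sum b X).

Definition missing_digit_measure (b : nat) X : probability R R :=
  distribution P (random_digit_sum b X : {RV P >-> R}).

End random_digits.

Section digit_sum_theory.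
Context {R : realType}.
Variable b : nat.
Hypothesis b1 : (1 < b)%N.
Implicit Types u v : nat -> nat.
Let c : R := b%:R.
Let S u n : R := series (fun i => (u i)%:R / c ^+ i.+1) n.

Let c0 : 0 < c. Proof. by rewrite ltr0n ltnW. Qed.

Let S_le u m n : (forall i, u i < b)%N -> (n <= m)%N ->
  S u n <= S u m <= S u n + c ^- n - c ^- m.
Proof.
move=> ub; elim: m => [|m IH].
  by rewrite leqn0 => /eqP ->; rewrite addrK lexx.
rewrite leq_eqVlt => /predU1P[->|]; first by rewrite addrK lexx.
rewrite ltnS => /IH/andP[h1 h2].
have -> : S u m.+1 = S u m + (u m)%:R / c ^+ m.+1.
  by rewrite /S /series/= big_nat_recr.
apply/andP; split.
  by rewrite (le_trans h1)// lerDl divr_ge0// exprn_ge0// ltW.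
have -> : S u n + c ^- n - c ^- m.+1 =
    (S u n + c ^- n - c ^- m) + (c - 1) / c ^+ m.+1.
  rewrite exprS mulrBl mul1r invfM mulrA divff ?gt_eqF//.
  by rewrite mul1r addrA subrK.
apply: lerD => //; apply: ler_wpM2r.
  by rewrite invr_ge0 exprn_ge0// ltW.
by rewrite lerBrDr natr1 ler_nat.
Qed.

Let S_cvg u : (forall i, u i < b)%N -> cvgn (S u).
Proof.
move=> ub; apply: nondecreasing_is_cvgn.
  by move=> m n mn; have /andP[] := S_le ub mn.
exists 1 => _ [n _ <-]; have /andP[_] := S_le ub (leq0n n).
rewrite {2}/S /series/= big_geq// add0r expr0 invr1 => /le_trans; apply.
by rewrite gerBl invr_ge0 exprn_ge0 ?ltW.
Qed.

Lemma digit_sum_bounds u n : (forall i, u i < b)%N ->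
  \sum_(0 <= i < n) (u i)%:R / c ^+ i.+1 <= digit_sum b u
    <= \sum_(0 <= i < n) (u i)%:R / c ^+ i.+1 + c ^- n.
Proof.
move=> ub; rewrite -[X in X <= _ <= X + _]/(S u n); apply/andP; split.
  apply: nondecreasing_cvgn_le; last exact: S_cvg.
  by move=> m k mk; have /andP[] := S_le ub mk.
apply: limr_le; first exact: S_cvg.
exists n => // m /= nm; have /andP[_] := S_le ub nm.
by move=> /le_trans; apply; rewrite gerBl invr_ge0 exprn_ge0 ?ltW.
Qed.

Lemma digit_sum_itv u : (forall i, u i < b)%N -> 0 <= (digit_sum b u : R) <= 1.
Proof.
by move=> /(digit_sum_bounds 0); rewrite big_geq// add0r expr0 invr1.
Qed.

Lemma digit_sum_dist u v n : (forall i, u i < b)%N -> (forall i, v i < b)%N ->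
  (forall i, (i < n)%N -> u i = v i) ->
  `|digit_sum b u - digit_sum b v| <= c ^- n.
Proof.
move=> ub vb uv.
have /andP[u1 u2] := digit_sum_bounds n ub.
have /andP[] := digit_sum_bounds n vb.
rewrite -(@eq_big_nat _ _ _ 0 n (fun i => (u i)%:R / c ^+ i.+1)); last first.
  by move=> i /andP[_ /uv ->].
move=> v1 v2; rewrite ler_norml lerBrDr lerBlDr; apply/andP; split.
  by rewrite addrC lerBlDr (le_trans v2)// lerD2r.
by rewrite (le_trans u2)// addrC lerD2l.
Qed.

Lemma expV_small (eps : R) : 0 < eps -> exists n, c ^- n < eps.
Proof.
move=> e0.
have : `|c^-1| < 1.
  by rewrite gtr0_norm ?invr_gt0// invf_lt1// ltr1n.
move=> /cvg_expr/cvgrPdist_lt/(_ _ e0)[n _ /(_ n (leqnn n))].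
by rewrite sub0r normrN exprVn gtr0_norm ?invr_gt0 ?exprn_gt0// => ?; exists n.
Qed.

Lemma compact_missing_digit_set (D : {fset nat}) :
  [set` D] `<=` `I_b -> compact (missing_digit_set b D : set R).
Proof.
move=> Db.
pose clip u i := minn (u i) b.-1.
have clipb u i : (clip u i < b)%N.
  by rewrite (leq_ltn_trans (geq_minr _ _))// prednK// ltnW.
pose A := [set u : prod_topology (fun _ : nat => nat) |
  forall i, [set` D] (u i)].
have cA : compact A.
  apply: (@tychonoff _ (fun=> nat) (fun=> [set` D])) => i.
  exact/finite_compact/finite_fset.
have clipE u : A u -> clip u = u.
  move=> Au; apply/funext => i; rewrite /clip; apply/minn_idPl.
  by rewrite -ltnS prednK// ?(ltnW b1)//; exact: Db.
pose g (u : prod_topology (fun _ : nat => nat)) : R := digit_sum b (clip u).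
have -> : missing_digit_set b D = g @` A.
  apply/seteqP; split => [x [_ [u [uD ->]]]|_ [u Au <-]].
    by exists u => //; rewrite /g clipE.
  split; first exact: digit_sum_itv.
  by exists u; split=> [i|]; [exact: Au|rewrite /g clipE].
apply: continuous_compact => //; apply: continuous_subspaceT => u.
apply/cvgrPdist_lt => /= eps e0; have [n ne] := expV_small e0.
have : \forall v \near u, forall i, (i < n)%N -> u i = v i.
  elim: n {ne} => [|n IH]; first by near=> v.
  have : \forall v \near u, u n = v n.
    have /(_ [set u n]) := @proj_continuous nat (fun=> nat) n u.
    move=> /(_ (discrete_set1 _)); apply: filterS => v /=.
    by move=> ->.
  apply: filterS2 IH => v vn uvn i; rewrite ltnS leq_eqVlt => /predU1P[->//|].
  exact: vn.
apply: filterS => v uv; rewrite (le_lt_trans _ ne)//.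
by apply: digit_sum_dist => // i /uv; rewrite /clip => ->.
Unshelve. all: by end_near. Qed.

End digit_sum_theory.

Section support.
Context {R : realType} {disp : measure_display} {T : measurableType disp}.
Variable P : probability T R.

Lemma msupport_missing_digit_measure b (D : {fset nat})
    (X : nat -> {RV P >-> nat}) : (1 < b)%N -> [set` D] `<=` `I_b ->
  (forall i, uniform_on D (X i)) -> mutually_independent X ->
  msupport (missing_digit_measure b X) = missing_digit_set b D.
Proof.
move=> b1 Db uX iX.
pose N := [set t | exists i, X i t \notin D].
have mX i (B : set nat) : measurable (X i @^-1` B).
  by rewrite -[X in measurable X]setTI; exact: measurable_funPT.
have mN : measurable N.
  rewrite (_ : N = \bigcup_i (X i @^-1` ~` [set` D])); last first.
    by apply/seteqP; split => [t [i /negP it]|t [i _ /negP it]]; exists i.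
  exact: bigcupT_measurable.
have PN : P N = 0%E.
  apply: measure_negligible => //.
  apply: (@negligibleS _ _ _ _ (\bigcup_i \bigcup_k
    if k \in D then set0 else X i @^-1` [set k])).
    by move=> t [i it]; exists i => //; exists (X i t); rewrite // (negbTE it).
  apply: negligible_bigcup => i; apply: negligible_bigcup => k.
  case: ifPn => kD; first exact: negligible_set0.
  by have := uX i k; rewrite (negbTE kD) => Pk; apply/(negligibleP P (mX i _)).
have NP t : ~ N t -> forall i, X i t \in D.
  by move=> nt i; apply/negPn/negP => h; apply: nt; exists i.
have nuE U : missing_digit_measure b X U = P (random_digit_sum b X @^-1` U).
  by [].
have mpre U : open U -> measurable (random_digit_sum b X @^-1` U).
  move=> oU; rewrite -[X in measurable X]setTI.
  by apply: measurable_random_digit_sum => //; exact: open_measurable.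
apply/seteqP; split => [x|_ [_ [u [uD ->]]] U oU Ux].
  apply: contraPP => xK /(_ (~` missing_digit_set b D)); apply/not_implyP.
  have oK : open (~` (missing_digit_set b D : set R)).
    rewrite openC; apply: compact_closed; first exact: Rhausdorff.
    exact: compact_missing_digit_set.
  split=> // /(_ xK); rewrite nuE; apply/negP; rewrite -leNgt -PN.
  apply: le_measure; rewrite ?inE//; first exact: mpre.
  move=> t /=; apply: contra_notP => /NP Xt; split; last by exists (X ^~ t).
  by apply: digit_sum_itv => // i; exact: Db (Xt i).
have /nbhs_ballP[eps /= e0 eU] : nbhs (digit_sum b u : R) U.
  exact: open_nbhs_nbhs.
have [n ne] := expV_small b1 e0.
pose J : {fset nat} := [fset i in iota 0 n]%fset.
pose E := \bigcap_(i in [set` J]) (X i @^-1` [set u i]).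
have mE : measurable E by exact: bigcap_measurableType.
have PE : (0 < P E)%E.
  rewrite /E iX; elim/big_ind : _ => //; first by move=> *; exact: mule_gt0.
  move=> i _; rewrite uX uD lte_fin invr_gt0 ltr0n cardfs_gt0.
  by apply/fset0Pn; exists (u i).
apply: (lt_le_trans PE).
have -> : P E = P (E `\` N).
  have PEoo : (P E < +oo)%E.
    by rewrite (le_lt_trans (probability_le1 _ _))// ltry.
  rewrite (measureD mE mN PEoo).
  rewrite [X in (_ - X)%E](_ : _ = 0%E) ?sube0//.
  apply/eqP; rewrite -measure_le0 -PN le_measure ?inE//.
  exact: measurableI.
apply: le_measure; rewrite ?inE//; [exact: measurableD|exact: mpre|].
move=> t [Et /NP Xt]; apply: eU; rewrite /ball/= (le_lt_trans _ ne)//.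
apply: digit_sum_dist => // [i|i|i ni]; [exact: Db (uD i)|exact: Db (Xt i)|].
by apply/esym/Et; rewrite /= !inE mem_iota.
Qed.

End support.

(* Main.v *)
(* If sum_(xi <= Q) |nu^(xi)| <= C Q^(1-s), then integrating Fejer's kernel
   against nu gives nu [c - r, c + r] = O(r^s), and the mass distribution
   principle yields dim_H (supp nu) >= s.

   Conversely, the covers by cylinders give dim_H K <= log l / log b, while
   |nu^(xi)| <= prod_(i <= n) |D_l (d xi / b^i)| / l with D_l the Dirichlet
   kernel.  Writing xi = xi' + t b^(n-1), only the factor i = n depends on
   the leading digit t, so the sum over xi < b^n is at most M^n, where M bounds
   (1/l) sum_(t < b) |D_l (d (x + t / b))|.  With b' = b / gcd (d, b) >= l, the
   points d (x + t / b) run, modulo 1, gcd (d, b) times over a translate of the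
   grid (1/b') Z, and |D_l y| <= min (l, 1 / (2 ||y||)) gives
   M <= (b / l) (4 + log (2 l)). *)

Require Import Defs.
From HB Require Import structures.
From mathcomp Require Import all_boot all_order all_algebra.
From mathcomp Require Import finmap.
From mathcomp Require Import all_classical all_reals all_analysis.
From mathcomp Require Import measurable_realfun complex.
From mathcomp Require Import ring lra zify.

Set Implicit Arguments.
Unset Strict Implicit.
Unset Printing Implicit Defensive.

Import Order.TTheory GRing.Theory Num.Theory.
Import numFieldNormedType.Exports.

Local Open Scope classical_set_scope.
Local Open Scope ring_scope.

(** * Trigonometric estimates and the Dirichlet kernel *)

Section trigonometry.
Context {R : realType}.
Implicit Types (x y : R) (n l : nat).

Lemma cos_lipschitz x y : `|cos x - cos y| <= `|x - y|.
Proof.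
wlog xy : x y / x <= y => [hw|].
  case: (leP x y) => [/hw//|/ltW/hw]; by rewrite distrC (distrC y).
have [|c _ h] := @MVT_segment R cos (fun z => - sin z) x y xy.
  by apply: continuous_subspaceT => z; exact: continuous_cos.
rewrite distrC h normrM normrN (distrC x) ler_piMl// sin_max//.
Qed.

Lemma sin_lipschitz x y : `|sin x - sin y| <= `|x - y|.
Proof.
rewrite -2!cosBpihalf (le_trans (cos_lipschitz _ _))//.
by rewrite opprB addrA subrK.
Qed.

(** Concavity by two uses of the mean value theorem: were [sin x] below the chord, the mean slopes
    on [[0, x]] and [[x, pi / 2]] would satisfy [cos u < 2 / pi < cos v] with [u < v], although
    [cos] decreases. *)
Lemma sin_ge_chord x : 0 <= x <= pi / 2 -> 2 / pi * x <= sin x.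
Proof.
move=> /andP[x0 xp]; have pi0 : 0 < pi :> R := pi_gt0 R.
have piE : 2 / pi * (pi / 2) = 1 :> R.
  by move: (pi : R) pi0 => p p0; field; exact: lt0r_neq0.
rewrite leNgt; apply/negP => hlt.
have x0' : 0 < x.
  rewrite lt_neqAle x0 andbT; apply/eqP => x0E.
  by move: hlt; rewrite -x0E sin0 mulr0 ltxx.
have xp' : x < pi / 2.
  rewrite lt_neqAle xp andbT; apply/eqP => xE; move: hlt.
  by rewrite xE sin_pihalf piE ltxx.
have csin z w : {within `[z, w], continuous (@sin R)}.
  by apply: continuous_subspaceT => ?; exact: continuous_sin.
have dsin (z w t : R) : t \in `]z, w[ -> is_derive t 1 (@sin R) (cos t).
  by move=> _; exact: is_derive_sin.
have [u ux hu] := MVT x0' (@dsin 0 x) (csin _ _).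
have [v vx hv] := MVT xp' (@dsin x (pi / 2)) (csin _ _).
move: ux vx; rewrite !in_itv/= => /andP[u0 ux] /andP[xv vp].
have : cos v < cos u by rewrite ltr_cos ?in_itv/=; lra.
move: hu hv; rewrite sin0 sin_pihalf !subr0 => hu hv.
have hu' : cos u < 2 / pi by rewrite -(ltr_pM2r x0') -hu.
have hv' : 2 / pi < cos v.
  rewrite -(@ltr_pM2r _ (pi / 2 - x)) ?subr_gt0// -hv mulrBr piE.
  by rewrite ltrD2l ltrN2.
by move=> /(lt_trans (lt_trans hu' hv')); rewrite ltxx.
Qed.

(** On [[0, 1]] the minimum is the distance of [x] to the integers; the chord bound covers the left
    half and the symmetry about [1 / 2] the right half. *)
Lemma sin_pi_ge x : 0 <= x <= 1 -> 2 * Num.min x (1 - x) <= sin (pi * x).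
Proof.
have pi0 : 0 < pi :> R := pi_gt0 R.
have jordan (z : R) : 0 <= z <= 2^-1 -> 2 * z <= sin (pi * z).
  move=> hz; have := @sin_ge_chord (pi * z).
  rewrite mulrA divfK ?gt_eqF//.
  by apply; nra.
move=> /andP[x0 x1]; rewrite minElt; case: ifPn => hx.
  by apply: jordan; lra.
rewrite -leNgt in hx.
have -> : sin (pi * x) = sin (pi * (1 - x)).
  by rewrite mulrBr mulr1 sinB sinpi cospi; ring.
by apply: jordan; lra.
Qed.

Lemma cexp2piD x y : cexp2pi (x + y) = cexp2pi x * cexp2pi y.
Proof.
by rewrite /cexp2pi mulrDr cosD sinD; congr (_ +i* _)%C; rewrite addrC.
Qed.

Lemma cexp2pi0 : cexp2pi 0 = 1 :> R[i].
Proof. by rewrite /cexp2pi mulr0 cos0 sin0. Qed.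

Lemma cexp2pi1 : cexp2pi 1 = 1 :> R[i].
Proof. by rewrite /cexp2pi mulr1 mulr_natl cos2pi sin2pi. Qed.

Lemma cexp2piMn n x : cexp2pi (n%:R * x) = cexp2pi x ^+ n.
Proof.
elim: n => [|n IH]; first by rewrite mul0r cexp2pi0 expr0.
by rewrite exprS -natr1 mulrDl mul1r addrC cexp2piD IH.
Qed.

Lemma cexp2pi_natr n : cexp2pi n%:R = 1 :> R[i].
Proof. by rewrite -[n%:R]mulr1 cexp2piMn cexp2pi1 expr1n. Qed.

Lemma normc_cexp2pi x : Normc.normc (cexp2pi x) = 1.
Proof. by rewrite /cexp2pi /Normc.normc cos2Dsin2 sqrtr1. Qed.

Lemma normc_cexp2piB1 x : Normc.normc (cexp2pi x - 1) = 2 * `|sin (pi * x)|.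
Proof.
rewrite /cexp2pi /Normc.normc/= subr0.
rewrite -[RHS]ger0_norm ?mulr_ge0// -sqrtr_sqr; congr Num.sqrt.
have -> : 2 * pi * x = (pi * x) *+ 2 by rewrite mulr2n; ring.
rewrite exprMn real_normK ?num_real//.
have := cos2Dsin2 (pi * x); have := cos2Dsin2 (pi * x *+ 2).
rewrite cos_mulr2n => h1 h2.
have -> : sin (pi * x *+ 2) ^+ 2 = 1 - (cos (pi * x) ^+ 2 *+ 2 - 1) ^+ 2.
  by lra.
have -> : sin (pi * x) ^+ 2 = 1 - cos (pi * x) ^+ 2 by lra.
by ring.
Qed.

Lemma normc_ge0 (z : R[i]) : 0 <= Normc.normc z.
Proof. by case: z => ? ?; exact: sqrtr_ge0. Qed.

Lemma normc_le_add (x y : R) : Normc.normc (x +i* y)%C <= `|x| + `|y|.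
Proof.
rewrite /Normc.normc -[leRHS]ger0_norm ?addr_ge0// -sqrtr_sqr ler_wsqrtr//.
rewrite sqrrD !real_normK ?num_real// -addrA lerD2l lerDr.
by rewrite mulrn_wge0// mulr_ge0.
Qed.

Lemma normc_sum (I : Type) (r : seq I) (Q : pred I) (F : I -> R[i]) :
  Normc.normc (\sum_(i <- r | Q i) F i) <=
    \sum_(i <- r | Q i) Normc.normc (F i).
Proof.
elim/big_ind2 : _ => //; first by rewrite Normc.normc0.
by move=> ? ? ? ? h1 h2; rewrite (le_trans (le_normcD _ _))// lerD.
Qed.

Lemma normc_prod (I : Type) (r : seq I) (Q : pred I) (F : I -> R[i]) :
  Normc.normc (\prod_(i <- r | Q i) F i) =
    \prod_(i <- r | Q i) Normc.normc (F i).
Proof.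
elim/big_ind2 : _ => //; first by rewrite Normc.normc1.
by move=> ? ? ? ? <- <-; rewrite Normc.normcM.
Qed.

Lemma normc_real x : Normc.normc (x%:C)%C = `|x|.
Proof. by rewrite /Normc.normc/= expr0n addr0 sqrtr_sqr. Qed.

(** Modulus of the one-sided kernel: shifting all frequencies by a constant only multiplies the sum
    by a unimodular factor. *)
Definition dirichlet l x : R :=
  Normc.normc (\sum_(k < l) cexp2pi (k%:R * x)).

Lemma dirichlet_ge0 l x : 0 <= dirichlet l x.
Proof. exact: normc_ge0. Qed.

Lemma dirichlet_le l x : dirichlet l x <= l%:R.
Proof.
rewrite (le_trans (normc_sum _ _ _))// (eq_bigr (fun=> 1)).
  by rewrite sumr_const card_ord.
by move=> i _; rewrite normc_cexp2pi.
Qed.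

Lemma dirichletDn l x n : dirichlet l (x + n%:R) = dirichlet l x.
Proof.
congr (Normc.normc _); apply: eq_bigr => k _.
by rewrite mulrDr cexp2piD -natrM cexp2pi_natr mulr1.
Qed.

Lemma dirichletN l x : dirichlet l (- x) = dirichlet l x.
Proof.
have conjE y : cexp2pi (- y) = ((cexp2pi y)^*)%C.
  by rewrite /cexp2pi/= mulrN cosN sinN.
rewrite /dirichlet; under eq_bigr do rewrite mulrN conjE.
rewrite -rmorph_sum; case: (\sum_(_ < _) _) => u v.
by rewrite /Normc.normc/= sqrrN.
Qed.

(** The geometric sum times [cexp2pi x - 1] is [cexp2pi (l x) - 1], of modulus at most [2], while
    [cexp2pi x - 1] has modulus [2 sin (pi x)]. *)
Lemma dirichlet_le_sin l x : 0 < x < 1 -> dirichlet l x <= (sin (pi * x))^-1.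
Proof.
move=> /andP[x0 x1]; have pi0 : 0 < pi :> R := pi_gt0 R.
have s0 : 0 < sin (pi * x) by apply: sin_gt0_pi; nra.
rewrite -[leRHS]mul1r ler_pdivlMr//.
have : dirichlet l x * (2 * sin (pi * x)) <= 2 * 1.
  rewrite -[sin (pi * x)]gtr0_norm// -normc_cexp2piB1 /dirichlet -Normc.normcM.
  under eq_bigr do rewrite cexp2piMn.
  rewrite mulrC -subrX1 -cexp2piMn normc_cexp2piB1 ler_wpM2l// sin_max//.
by lra.
Qed.

End trigonometry.

(** * Sums of the Dirichlet kernel over grids *)

Section kernel_sum.
Context {R : realType}.
Implicit Types (m n l : nat).

(** Each step of the induction is [1 / (n + 1) <= ln ((n + 1) / n)], that is, [ln (1 + u) <= u] at
    [u = - 1 / (n + 1)]. *)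
Lemma harmonic_sum_le m n : (0 < m <= n)%N ->
  \sum_(m <= j < n.+1) (j%:R : R)^-1 <= m%:R^-1 + ln (n%:R / m%:R).
Proof.
move=> /andP[m0]; have m0' : 0 < m%:R :> R by rewrite ltr0n.
elim: n => [|n IH]; first by case: m m0 {m0'}.
rewrite leq_eqVlt => /predU1P[<-|].
  by rewrite big_nat1 divff ?gt_eqF// ln1 addr0.
rewrite ltnS => mn; have n0 : (0 < n)%N := leq_trans m0 mn.
have n0' : 0 < n%:R :> R by rewrite ltr0n.
rewrite big_nat_recr/=; last exact: leqW.
rewrite (le_trans (lerD (IH mn) (lexx _)))// -addrA lerD2l.
have -> : n.+1%:R / m%:R = n%:R / m%:R * (n.+1%:R / n%:R) :> R.
  by field; rewrite ?gt_eqF.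
rewrite [leRHS]lnM ?posrE ?divr_gt0 ?ltr0n// lerD2l.
rewrite -[X in ln X]invf_div lnV ?posrE ?divr_gt0 ?ltr0n// lerNr.
have -> : n%:R / n.+1%:R = 1 + (- n.+1%:R^-1) :> R.
  by rewrite -natr1; field; rewrite natr1 gt_eqF// ltr0n.
apply: le_ln1Dx; rewrite ltrN2 invf_lt1 ?ltr1n ?ltr0n//.
Qed.

Lemma truncated_harmonic_sum_le (h : nat -> R) l n :
  (1 < l <= n)%N -> (forall j, (j < n)%N -> h j <= l%:R) ->
  (forall j, (0 < j < n)%N -> h j <= n%:R / 2 / j%:R) ->
  \sum_(0 <= j < n) h j <= l%:R + n%:R + n%:R / 2 * ln (2 * l%:R).
Proof.
move=> /andP[l1 ln'] h1 h2.
(* below [m] the bound [l] is the smaller one, above it [n / (2 j)] *)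
pose m := (n %/ (2 * l)).+1.
have m1 : (0 < m)%N by [].
have mn : (m <= n.-1)%N by rewrite /m; nia.
have m0 : 0 < m%:R :> R by rewrite ltr0n.
have n0 : 0 < n%:R :> R by rewrite ltr0n; lia.
have l0 : 0 < l%:R :> R by rewrite ltr0n; lia.
rewrite (@big_cat_nat _ _ _ m)//=; last by lia.
(* As [m - 1 <= n / (2 l)], the terms below [m] cost at most [l + n / 2]. *)
have s1 : \sum_(0 <= j < m) h j <= l%:R + n%:R / 2.
  rewrite (@le_trans _ _ (\sum_(0 <= j < m) l%:R))//.
    by rewrite ler_sum_nat// => j ?; apply: h1; lia.
  rewrite sumr_const_nat subn0 -[leLHS]mulr_natr /m -natr1.
  rewrite mulrDr mulr1 addrC lerD2l.
  rewrite ler_pdivlMr// -!natrM ler_nat; nia.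
have s2 : \sum_(m <= j < n) h j <= n%:R / 2 + n%:R / 2 * ln (2 * l%:R).
  rewrite (@le_trans _ _ (n%:R / 2 * \sum_(m <= j < n) j%:R^-1))//.
    by rewrite mulr_sumr ler_sum_nat// => j ?; apply: h2; lia.
  rewrite -{2}[n%:R / 2]mulr1 -mulrDr ler_wpM2l ?divr_ge0//.
  have -> : n = n.-1.+1 by lia.
  have mn' : (0 < m <= n.-1)%N by rewrite m1.
  rewrite (le_trans (harmonic_sum_le mn'))//.
  (* Here [1 <= m] bounds [1 / m], and [n < 2 l m] bounds the argument of the logarithm. *)
  apply: lerD; first by rewrite invf_le1 // ler1n.
  rewrite ler_ln ?posrE ?divr_gt0 ?mulr_gt0 ?ltr0n//; try lia.
  rewrite ler_pdivrMr// -!natrM ler_nat.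
  have := ltn_ceil n (isT : 0 < 2)%N.
  have := @ltn_ceil n (2 * l); rewrite -/m; nia.
by rewrite (le_trans (lerD s1 s2))//; lra.
Qed.

(** The [t]-th point lies in [[t / n, (t + 1) / n)], hence at distance at least [t / n] from [0] and
    [(n - t - 1) / n] from [1]. Charging it to the nearer of the two bounds the sum by twice a
    truncated harmonic sum, and [l <= n] turns [2 l + 2 n] into [4 n]. *)
Lemma dirichlet_grid_sum_le l n (y : R) :
  (1 < l <= n)%N -> 0 <= y < n%:R^-1 ->
  \sum_(0 <= t < n) dirichlet l (y + t%:R / n%:R) <=
    n%:R * (4 + ln (2 * l%:R)).
Proof.
move=> lln /andP[y0 yn]; have /andP[l1 ln'] := lln.
have n0 : 0 < n%:R :> R by rewrite ltr0n; lia.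
(* Next to an integer only the trivial bound [l] remains; index [0] is set apart because [n / 2 / 0]
   evaluates to [0]. *)
pose h (j : nat) : R :=
  if j == 0%N then l%:R else Num.min l%:R (n%:R / 2 / j%:R).
have h0 j : 0 <= h j.
  by rewrite /h; case: ifPn => // _; rewrite le_min ler0n !divr_ge0.
have Dh t : (t < n)%N ->
    dirichlet l (y + t%:R / n%:R) <= h t + h (n - t.+1)%N.
  move=> tn; set th := y + _.
  have th1 : t%:R / n%:R <= th by rewrite lerDr.
  have th2 : th < t.+1%:R / n%:R.
    by rewrite /th -natr1 mulrDl mul1r addrC ltrD2l.
  have jE : (n - t.+1)%:R = n%:R - t.+1%:R :> R by rewrite natrB.
  have th3 : th < 1.
    by rewrite (lt_le_trans th2)// ler_pdivrMr// mul1r ler_nat.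
  have aux (j : nat) (w : R) : (0 < j)%N -> j%:R / n%:R <= w ->
      2 * w <= sin (pi * th) -> (sin (pi * th))^-1 <= n%:R / 2 / j%:R.
    move=> j0 jw ws; have j0' : 0 < j%:R / n%:R :> R.
      by rewrite divr_gt0// ltr0n.
    have -> : n%:R / 2 / j%:R = (2 * (j%:R / n%:R))^-1 :> R.
      by rewrite !invfM invrK; ring.
    rewrite lef_pV2 ?posrE//; first by rewrite (le_trans _ ws)// ler_pM2l.
      by rewrite (lt_le_trans _ ws)// mulr_gt0// (lt_le_trans j0').
    by rewrite mulr_gt0.
  have [th5|th5] := leP th 2^-1.
    rewrite -[leLHS]addr0 lerD// /h; case: ifPn => [_|t0].
      exact: dirichlet_le.
    have thp : 0 < th.
      by rewrite (lt_le_trans _ th1)// divr_gt0// ltr0n lt0n.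
    rewrite le_min dirichlet_le/= (le_trans (dirichlet_le_sin _ _)) ?thp//.
    apply: (aux _ th) => //; first by rewrite lt0n.
    have := @sin_pi_ge R th; rewrite min_l; last lra.
    by apply; lra.
  rewrite -[leLHS]add0r lerD// /h; case: ifPn => [_|t0].
    exact: dirichlet_le.
  rewrite le_min dirichlet_le/= (le_trans (dirichlet_le_sin _ _))//; first lra.
  apply: (aux _ (1 - th)); first by rewrite lt0n.
    rewrite jE mulrBl divff ?gt_eqF// lerD2l lerN2 ltW//.
  have := @sin_pi_ge R th; rewrite min_r; last lra.
  by apply; lra.
apply: (@le_trans _ _ (\sum_(0 <= t < n) (h t + h (n - t.+1)%N))).
  by rewrite ler_sum_nat// => t /andP[_]; exact: Dh.
have rev : \sum_(0 <= t < n) h (n - t.+1)%N = \sum_(0 <= t < n) h t.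
  by rewrite [RHS]big_nat_rev.
rewrite big_split/= rev.
have hs : \sum_(0 <= j < n) h j <= l%:R + n%:R + n%:R / 2 * ln (2 * l%:R).
  apply: truncated_harmonic_sum_le => // j; rewrite /h.
    by case: ifPn => // _ _; rewrite ge_min lexx.
  by case: ifPn => [/eqP ->//|_ _]; rewrite ge_min lexx orbT.
have lnR : l%:R <= n%:R :> R by rewrite ler_nat.
move: hs lnR; set H := \sum_(_ <= _ < _) _; set L := ln _.
by move=> *; nra.
Qed.

(** Multiplication by a unit modulo [n], followed by a translation, permutes the residues. *)
Lemma sum_affine_modn (G : nat -> R) d z n : coprime d n -> (0 < n)%N ->
  \sum_(0 <= t < n) G ((z + d * t) %% n)%N = \sum_(0 <= t < n) G t.
Proof.
move=> dn n0; rewrite !big_mkord.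
pose f (t : 'I_n) : 'I_n := Ordinal (ltn_pmod (z + d * t) n0).
have finj : injective f.
  move=> i j /(congr1 val)/= /eqP; rewrite eqn_modDl => ij; apply: val_inj.
  wlog ij' : i j ij / (i <= j)%N.
    move=> hw; case: (leqP i j) => [/hw|/ltnW/hw h]; first exact.
    by rewrite -h// eq_sym.
  move: ij; rewrite eq_sym eqn_mod_dvd ?leq_mul2l ?ij' ?orbT// -mulnBr.
  rewrite Gauss_dvdr 1?coprime_sym// => nij.
  have := ltn_ord j; have [//|ltij jn] := eqVneq (i : nat) j.
  by move: nij; rewrite gtnNdvd//; lia.
by rewrite [RHS](reindex_inj finj).
Qed.

Lemma sum_blocks (F : nat -> R) m k :
  \sum_(0 <= t < m * k) F t =
    \sum_(0 <= j < k) \sum_(0 <= t < m) F (t + m * j)%N.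
Proof.
elim: k => [|k IH]; first by rewrite muln0 !big_geq.
rewrite (@big_cat_nat _ _ _ (m * k)) ?leq_mul2l ?leqnSn ?orbT//= IH.
rewrite big_nat_recr//=; congr +%R.
by rewrite mulnS -{1}[(m * k)%N]add0n big_addn addnK.
Qed.

Lemma sum_periodic (F : nat -> R) n k : (forall t, F (t + n)%N = F t) ->
  \sum_(0 <= t < n * k) F t = k%:R * \sum_(0 <= t < n) F t.
Proof.
move=> Fn; rewrite sum_blocks (eq_bigr (fun=> \sum_(0 <= t < n) F t)).
  by rewrite sumr_const_nat subn0 mulr_natl.
move=> j _; apply: eq_bigr => t _.
elim: j => [|j IH]; first by rewrite muln0 addn0.
by rewrite mulnS (addnC n) addnA Fn.
Qed.

Lemma dirichlet_sum_le l b d (x : R) :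
  (1 < l)%N -> (0 < d)%N -> (d * l.-1 < b)%N -> 0 <= x ->
  \sum_(0 <= t < b) dirichlet l (d%:R * (x + t%:R / b%:R)) <=
    b%:R * (4 + ln (2 * l%:R)).
Proof.
move=> l1 d0 dlb x0.
have b0 : (0 < b)%N := leq_ltn_trans (leq0n _) dlb.
pose g := gcdn d b; have g0 : (0 < g)%N by rewrite gcdn_gt0 d0.
pose n := (b %/ g)%N; pose e := (d %/ g)%N.
have bE : b = (n * g)%N by rewrite divnK// dvdn_gcdr.
have dE : d = (e * g)%N by rewrite divnK// dvdn_gcdl.
have n0 : (0 < n)%N by rewrite divn_gt0// dvdn_leq// dvdn_gcdr.
have en : coprime e n.
  by rewrite /coprime -(eqn_pmul2r g0) muln_gcdl -dE -bE mul1n.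
(* Dividing [d (l - 1) < b] by [g] leaves [e (l - 1) < n] with [e >= 1]. *)
have ln' : (l <= n)%N.
  have e0 : (0 < e)%N by lia.
  nia.
have n0' : 0 < n%:R :> R by rewrite ltr0n.
have g0' : 0 < g%:R :> R by rewrite ltr0n.
(* The integer part [z] of [w = n d x] shifts the grid index, so that only an offset [y] in
   [[0, 1 / n)] remains. *)
pose w : R := d%:R * x * n%:R.
have w0 : 0 <= w by rewrite !mulr_ge0.
pose z := Num.truncn w; have /andP[z1 z2] := truncn_itv w0.
pose y : R := d%:R * x - z%:R / n%:R.
pose F t : R := dirichlet l (y + t%:R / n%:R).
have FE t : dirichlet l (d%:R * (x + t%:R / b%:R)) = F ((z + e * t) %% n)%N.
  rewrite /F -[RHS](dirichletDn _ _ ((z + e * t) %/ n)); congr dirichlet.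
  have -> : d%:R * (x + t%:R / b%:R) = y + (z + e * t)%:R / n%:R.
    rewrite /y mulrDr natrD natrM mulrDl addrA subrK; congr +%R.
    by rewrite dE bE !natrM; field; rewrite ?gt_eqF.
  rewrite {1}(divn_eq (z + e * t) n) natrD natrM mulrDl mulfK ?gt_eqF//.
  by rewrite [X in y + X]addrC addrA.
rewrite (eq_bigr (fun t => F ((z + e * t) %% n)%N)); last by move=> t _.
rewrite {1}bE sum_periodic; last first.
  by move=> t; rewrite mulnDr addnA addnC modnMDl.
rewrite sum_affine_modn// bE natrM [n%:R * g%:R]mulrC -mulrA ler_pM2l//.
apply: dirichlet_grid_sum_le; first by rewrite l1.
rewrite /y subr_ge0 ler_pdivrMr// z1/= ltrBlDr.
by rewrite -(ltr_pM2r n0') mulrDl mulVf ?divfK ?gt_eqF// addrC natr1.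
Qed.

Lemma prod_dirichlet_sum_le l b d n :
  (1 < l)%N -> (0 < d)%N -> (d * l.-1 < b)%N ->
  \sum_(0 <= k < b ^ n)
      \prod_(i < n) (dirichlet l (d%:R * (k%:R / b%:R ^+ i.+1)) / l%:R : R)
    <= (b%:R * (4 + ln (2 * l%:R)) / l%:R) ^+ n.
Proof.
move=> l1 d0 dlb; have b0 : (0 < b)%N := leq_ltn_trans (leq0n _) dlb.
have b0' : b%:R != 0 :> R by rewrite pnatr_eq0 -lt0n.
set M := _ / l%:R.
have M0 : 0 <= M.
  rewrite divr_ge0// mulr_ge0// addr_ge0// ln_ge0// -natrM ler1n; lia.
pose f i k : R := dirichlet l (d%:R * (k%:R / b%:R ^+ i.+1)) / l%:R.
have f0 i k : 0 <= f i k by rewrite divr_ge0// dirichlet_ge0.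
elim: n => [|n IH]; first by rewrite expn0 big_nat1 big_ord0 expr0.
rewrite expnSr sum_blocks exchange_big/= exprSr.
rewrite (@le_trans _ _ (\sum_(0 <= k < b ^ n) (\prod_(i < n) f i k) * M))//.
  rewrite ler_sum_nat// => k _.
  rewrite (eq_bigr (fun t =>
      (\prod_(i < n) f i k) * f n (k + b ^ n * t)%N)); last first.
    move=> t _; rewrite big_ord_recr/=; congr *%R.
    apply: eq_bigr => i _; rewrite /f; congr (_ / _).
    (* For [i < n] the leading digit [t] moves the argument by the integer [d b ^ (n - i - 1) t]. *)
    rewrite -[RHS](dirichletDn _ _ (d * (b ^ (n - i.+1) * t))).
    congr dirichlet; rewrite natrM -mulrDr; congr *%R.
    rewrite natrD mulrDl; congr +%R.
    have -> : (b ^ n = b ^ i.+1 * b ^ (n - i.+1))%N.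
      by rewrite -expnD subnKC.
    rewrite -mulnA natrM natrX.
    by rewrite [X in X / _]mulrC mulfK// expf_neq0.
  rewrite -mulr_sumr ler_wpM2l ?prodr_ge0//.
  rewrite /f -mulr_suml ler_wpM2r ?invr_ge0//.
  have := @dirichlet_sum_le l b d (k%:R / b%:R ^+ n.+1) l1 d0 dlb.
  rewrite divr_ge0 ?exprn_ge0// => /(_ isT); apply: le_trans.
  rewrite le_eqVlt; apply/orP; left; apply/eqP/eq_bigr => t _.
  congr dirichlet; congr *%R; rewrite natrD mulrDl; congr +%R.
  by rewrite natrM natrX exprSr; field; rewrite b0' expf_neq0.
by rewrite -mulr_suml ler_wpM2r.
Qed.

End kernel_sum.

(** * Integrals of bounded functions against a probability measure *)

Section bounded_integrals.
Context d (T : measurableType d) (R : realType) (P : probability T R).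
Implicit Types (A : set T) (f : T -> R).

Lemma bounded_integrable A f (M : R) : measurable A -> measurable_fun setT f ->
  (forall x, `|f x| <= M) -> P.-integrable A (EFin \o f).
Proof.
move=> mA mf fM; apply: measurable_bounded_integrable => //.
- by rewrite (le_lt_trans (probability_le1 _ _))// ltry.
- exact: measurable_funTS.
- exists M; split; first exact: num_real.
  by move=> x /ltW Mx y _; exact: le_trans Mx.
Qed.

Lemma Rintegral_sum A (I : Type) (s : seq I) (F : I -> T -> R) :
  measurable A -> (forall i, P.-integrable A (EFin \o F i)) ->
  \int[P]_(x in A) (\sum_(i <- s) F i x) = \sum_(i <- s) \int[P]_(x in A) F i x.
Proof.
move=> mA iF; elim: s => [|i s IH].
  rewrite big_nil; under eq_Rintegral do rewrite big_nil.
  by rewrite Rintegral_cst// mul0r.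
rewrite big_cons -IH -RintegralD//.
  by apply: eq_Rintegral => x _; rewrite big_cons.
rewrite (_ : _ \o _ = fun x => (\sum_(i <- s) (F i x)%:E)%E).
  by apply: integrable_sum => // j _; exact: iF.
by apply/funext => x /=; rewrite sumEFin.
Qed.

(** Serves to move an integral to and from an event of probability one, on which pointwise facts are
    available. *)
Lemma Rintegral_full A f (M : R) : measurable A -> P A = 1%E ->
  measurable_fun setT f -> (forall x, `|f x| <= M) ->
  \int[P]_(x in A) f x = \int[P]_x f x.
Proof.
move=> mA PA mf fM; rewrite /Rintegral.
rewrite [in RHS](@negligible_integral _ _ _ _ _ (~` A))//.
- by rewrite setTD setCK.
- exact: measurableC.
- exact: bounded_integrable fM.
- by rewrite [LHS]probability_setC// PA subee.
Qed.

End bounded_integrals.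

(** * Fourier coefficients of the random digit sum *)

Section random_digits.
Context {R : realType} {disp : measure_display} {T : measurableType disp}.
Variables (P : probability T R) (b : nat) (D : {fset nat}).
Variable X : nat -> {RV P >-> nat}.
Hypotheses (b1 : (1 < b)%N) (Db : [set` D] `<=` `I_b).
Hypotheses (X_uniform : forall i, uniform_on D (X i)).
Hypothesis X_indep : mutually_independent X.

Let nu := missing_digit_measure b X.
Let c : R := (#|` D|%fset%:R)^-1.
Let c0 : 0 <= c. Proof. by rewrite invr_ge0. Qed.

Let mX i (B : set nat) : measurable (X i @^-1` B).
Proof. by rewrite -[X in measurable X]setTI; exact: measurable_funPT. Qed.

(** Uniformity keeps the digits in [D] only almost surely; the pointwise bounds on digit sums are
    applied on this event. *)
Definition good_digits := [set t | forall i, X i t \in D].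

Lemma measurable_good_digits : measurable good_digits.
Proof.
rewrite (_ : good_digits = \bigcap_i (X i @^-1` [set` D])).
  exact: bigcapT_measurable.
by apply/seteqP; split => [t gt i _|t gt i]; [exact: gt|exact: (gt i I)].
Qed.

Lemma probability_good_digits : P good_digits = 1%E.
Proof.
have mG := measurable_good_digits.
suff h : P (~` good_digits) = 0%E.
  rewrite -[good_digits]setCK [LHS]probability_setC ?h ?sube0//.
  exact: measurableC.
apply: measure_negligible; first exact: measurableC.
apply: (@negligibleS _ _ _ _ (\bigcup_i \bigcup_k
  if k \in D then set0 else X i @^-1` [set k])).
  move=> t /existsNP[i /negP it]; exists i => //; exists (X i t) => //.
  by rewrite (negbTE it).
apply: negligible_bigcup => i; apply: negligible_bigcup => k.
case: ifPn => kD; first exact: negligible_set0.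
have := X_uniform i k; rewrite (negbTE kD) => Pk.
exact/(negligibleP P (mX i _)).
Qed.

Lemma good_digits_sum t : good_digits t ->
  missing_digit_set b D (random_digit_sum b X t : R).
Proof.
move=> gt; split; last by exists (X ^~ t).
by apply: digit_sum_itv => // i; exact: Db (gt i).
Qed.

Lemma missing_digit_measure_full : nu (missing_digit_set b D) = 1%E.
Proof.
have mK : measurable (missing_digit_set b D : set R).
  apply: closed_measurable; apply: compact_closed; first exact: Rhausdorff.
  exact: compact_missing_digit_set.
apply/eqP; rewrite eq_le probability_le1//= -probability_good_digits.
apply: le_measure; rewrite ?inE.
- exact: measurable_good_digits.
- by rewrite -[X in measurable X]setTI; exact: measurable_random_digit_sum.
- exact: good_digits_sum.
Qed.

Definition partial_digit_sum m t : R := \sum_(i < m) (X i t)%:R / b%:R ^+ i.+1.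

Lemma measurable_partial_digit_sum m :
  measurable_fun setT (partial_digit_sum m).
Proof.
apply: measurable_sum => i.
rewrite (_ : (fun _ => _) = (fun n : nat => n%:R / b%:R ^+ i.+1 : R) \o X i)//.
exact: measurableT_comp.
Qed.

Let cyl m (w : {ffun 'I_m -> D}) :=
  [set t | forall i : 'I_m, X i t = val (w i)].

(** Puts the cylinder in the shape of [mutually_independent]; the default [0] is never reached,
    since [i < m]. *)
Let cylE m (w : {ffun 'I_m -> D}) : cyl w =
  \bigcap_(i in [set` [fset i in iota 0 m]%fset])
    (X i @^-1` [set if insub i is Some j then val (w j) else 0%N]).
Proof.
apply/seteqP; split => t /=.
  move=> wt i /=; rewrite !inE mem_iota/= add0n => im.
  by rewrite insubT /= -(wt (Sub i im)).
move=> wt i; have /(_ (val i)) := wt.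
rewrite /= !inE mem_iota/= add0n => /(_ (ltn_ord i)).
by rewrite valK.
Qed.

Let mcyl m (w : {ffun 'I_m -> D}) : measurable (cyl w).
Proof. by rewrite cylE; exact: bigcap_measurableType. Qed.

Let Pcyl m (w : {ffun 'I_m -> D}) : P (cyl w) = (c ^+ m)%:E.
Proof.
rewrite cylE X_indep (perm_big (iota 0 m)); last first.
  by apply: uniq_perm; rewrite ?iota_uniq ?fset_uniq// => i; rewrite !inE.
rewrite -{1}[m]subn0 -/(index_iota 0 m) big_mkord.
under eq_bigr do rewrite valK X_uniform fsvalP.
by rewrite prodEFin prodr_const card_ord.
Qed.

(** On [good_digits] the first [m] digits form one of finitely many words: the cylinders are
    disjoint, cover this event, and each has mass [c ^ m] by independence. *)
Lemma Rintegral_partial_digit_sum (f : R -> R) (M : R) m :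
  measurable_fun setT f -> (forall x, `|f x| <= M) ->
  \int[P]_t f (partial_digit_sum m t) =
  \sum_(w : {ffun 'I_m -> D})
    c ^+ m * f (\sum_(i < m) (val (w i))%:R / b%:R ^+ i.+1).
Proof.
move=> mf fM; pose s (w : {ffun 'I_m -> D}) : R :=
  \sum_(i < m) (val (w i))%:R / b%:R ^+ i.+1.
have mG := measurable_good_digits.
have iI (w : {ffun 'I_m -> D}) :
    P.-integrable setT (EFin \o (\1_(cyl w) : T -> R)).
  apply: (@bounded_integrable _ _ _ _ _ _ 1) => // x.
  by rewrite indicE; case: (_ \in _); rewrite ?normr1 ?normr0.
have iF w : P.-integrable setT (EFin \o (fun t => f (s w) * \1_(cyl w) t)).
  by have := integrableZl measurableT (f (s w)) (iI w).
rewrite -(@Rintegral_full _ _ _ _ good_digits _ M)//; first last.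
- exact: (measurableT_comp mf (measurable_partial_digit_sum m)).
- exact: probability_good_digits.
transitivity (\int[P]_(t in good_digits) \sum_w f (s w) * \1_(cyl w) t).
  apply: eq_Rintegral => t /[!inE] gt.
  (* Of all words, only the one formed by the first [m] digits of [t] contributes. *)
  pose w0 : {ffun 'I_m -> D} := [ffun i : 'I_m => FSetSub (gt i)].
  rewrite (bigD1 w0)//= big1 ?addr0.
    rewrite indicE mem_set ?mulr1; last by move=> i; rewrite ffunE.
    by congr f; apply: eq_bigr => i _; rewrite ffunE.
  move=> w ww0; rewrite indicE memNset ?mulr0// => wt; move/eqP : ww0; apply.
  by apply/ffunP => i; apply: val_inj; rewrite ffunE/= wt.
have bd x : `|\sum_w f (s w) * (\1_(cyl w) x : R)| <=
    \sum_(w : {ffun 'I_m -> D}) M.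
  rewrite (le_trans (ler_norm_sum _ _ _))// ler_sum// => w _.
  rewrite normrM -[leRHS]mulr1 ler_pM// indicE.
  by case: (_ \in _); rewrite ?normr1 ?normr0.
rewrite (@Rintegral_full _ _ _ _ good_digits _ _ _ _ _ bd)//; first last.
- by apply: measurable_sum => w; apply: measurable_funM.
- exact: probability_good_digits.
rewrite Rintegral_sum//; apply: eq_bigr => w _.
have -> : c ^+ m = fine (P (cyl w)) by rewrite Pcyl.
by rewrite RintegralZl// /Rintegral integral_indic// setIT mulrC.
Qed.

(** Change of variables; restricting to [[0, 1]] loses nothing, as the digit sum lies there almost
    surely. *)
Lemma Rintegral_missing_digit_measure (f : R -> R) (M : R) :
  measurable_fun setT f -> (forall x, `|f x| <= M) ->
  \int[nu]_(x in `[0, 1]) f x = \int[P]_t f (random_digit_sum b X t).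
Proof.
move=> mf fM.
have mS := measurable_random_digit_sum b X.
have mA : measurable (random_digit_sum b X @^-1` `[0, 1]).
  by rewrite -[X in measurable X]setTI; exact: mS.
rewrite {1}/Rintegral integral_pushforward//=; last 2 first.
- exact/measurable_EFinP.
- apply: (@bounded_integrable _ _ _ _ _ _ M) => //.
  exact: measurableT_comp.
rewrite -[LHS]/(\int[P]_(t in _) f (random_digit_sum b X t)).
apply: (@Rintegral_full _ _ _ _ _ _ M) => //; last exact: measurableT_comp.
apply/eqP; rewrite eq_le probability_le1//= -probability_good_digits.
apply: le_measure; rewrite ?inE//; first exact: measurable_good_digits.
by move=> t /good_digits_sum[]; rewrite /= in_itv.
Qed.

(* The tail of the expansion moves the digit sum by at most [b ^- m]. *)
Lemma Rintegral_digit_sum_approx (f : R -> R) (M L : R) m :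
  measurable_fun setT f -> (forall x, `|f x| <= M) ->
  (forall x y, `|f x - f y| <= L * `|x - y|) -> 0 <= L ->
  `|\int[nu]_(x in `[0, 1]) f x -
    \int[P]_t f (partial_digit_sum m t)| <= L * b%:R ^- m.
Proof.
move=> mf fM fL L0; rewrite (Rintegral_missing_digit_measure mf fM).
have mG := measurable_good_digits; have PG := probability_good_digits.
have mS := measurable_random_digit_sum b X.
have b1' t : `|(f \o random_digit_sum b X) t| <= M by exact: fM.
have b2' t : `|(f \o partial_digit_sum m) t| <= M by exact: fM.
have m1 : measurable_fun setT (f \o random_digit_sum b X).
  exact: measurableT_comp.
have m2 : measurable_fun setT (f \o partial_digit_sum m).
  exact: (measurableT_comp mf (measurable_partial_digit_sum m)).
rewrite -(@Rintegral_full _ _ _ _ good_digits _ _ mG PG m1 b1').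
rewrite -(@Rintegral_full _ _ _ _ good_digits _ _ mG PG m2 b2').
have i1 : P.-integrable good_digits (EFin \o (f \o random_digit_sum b X)).
  exact: bounded_integrable b1'.
have i2 : P.-integrable good_digits (EFin \o (f \o partial_digit_sum m)).
  exact: bounded_integrable b2'.
have i3 := integrableB mG i1 i2.
rewrite -RintegralB// (le_trans (le_normr_Rintegral mG i3))//.
have -> : L * b%:R ^- m = \int[P]_(t in good_digits) (L * b%:R ^- m).
  transitivity (L * b%:R ^- m * fine (P good_digits)).
    by rewrite PG mulr1.
  by rewrite Rintegral_cst.
apply: le_Rintegral => //.
- exact: integrable_norm i3.
- exact: finite_measure_integrable_cst.
move=> t gt /=; rewrite (le_trans (fL _ _))// ler_wpM2l//.
have ub i : (X i t < b)%N by exact: Db (gt i).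
have := @digit_sum_bounds R b b1 (X ^~ t) m ub.
rewrite big_mkord -/(partial_digit_sum m t) -/(random_digit_sum b X t).
by move=> /andP[h1 h2]; rewrite ger0_norm ?subr_ge0// lerBlDl.
Qed.

(* Modulus of the characteristic function of the [i]-th summand
   [X i / b ^ i.+1] of the digit sum. *)
Definition digit_factor (xi i : nat) : R := Normc.normc
  (\sum_(k : D) cexp2pi (- (xi%:R * ((val k)%:R / b%:R ^+ i.+1)))) /
  #|` D|%fset%:R.

Let q := digit_factor.

Let q0 xi i : 0 <= q xi i. Proof. by rewrite mulr_ge0// normc_ge0. Qed.

Let q1 xi i : q xi i <= 1.
Proof.
have [D0|D0] := eqVneq (#|` D|)%fset 0%N.
  by rewrite /q /digit_factor D0 invr0 mulr0 ler01.
rewrite ler_pdivrMr ?ltr0n ?lt0n// mul1r (le_trans (normc_sum _ _ _))//.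
rewrite (eq_bigr (fun=> 1)); last by move=> k _; rewrite normc_cexp2pi.
by rewrite sumr_const -cardfE.
Qed.

(** Cutting after [m] digits costs [2 pi xi b ^- m] in the real and in the imaginary part, [2 pi xi]
    being a Lipschitz constant of both; the coefficient of the truncated sum factors over the digits
    by independence. *)
Lemma fourier_approx (xi m : nat) :
  Normc.normc (fourier nu xi%:Z) <=
    \prod_(i < m) digit_factor xi i + 2 * (2 * pi * xi%:R * b%:R ^- m).
Proof.
have pi0 : 0 <= pi :> R := pi_ge0 R.
pose f (x : R) : R := complex.Re (cexp2pi (- (xi%:R * x) : R)).
pose g (x : R) : R := complex.Im (cexp2pi (- (xi%:R * x) : R)).
pose L : R := 2 * pi * xi%:R.
have L0 : 0 <= L by rewrite !mulr_ge0.
have angle (x y : R) :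
    `|2 * pi * - (xi%:R * x) - 2 * pi * - (xi%:R * y)| = L * `|x - y|.
  rewrite -(ger0_norm L0) -normrM -normrN; congr Num.norm.
  by rewrite /L; ring.
have fL x y : `|f x - f y| <= L * `|x - y|.
  by rewrite /f /= (le_trans (cos_lipschitz _ _))// angle.
have gL x y : `|g x - g y| <= L * `|x - y|.
  by rewrite /g /= (le_trans (sin_lipschitz _ _))// angle.
have f1 x : `|f x| <= 1 by rewrite cos_max.
have g1 x : `|g x| <= 1 by rewrite sin_max.
have mlin : measurable_fun setT (fun x : R => 2 * pi * - (xi%:R * x)).
  apply: measurable_funM => //; exact: measurableT_comp.
have mf : measurable_fun setT f.
  apply: (measurableT_comp _ mlin).
  by apply: continuous_measurable_fun; exact: continuous_cos.
have mg : measurable_fun setT g.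
  apply: (measurableT_comp _ mlin).
  by apply: continuous_measurable_fun; exact: continuous_sin.
have := Rintegral_digit_sum_approx m mf f1 fL L0.
have := Rintegral_digit_sum_approx m mg g1 gL L0.
rewrite (Rintegral_partial_digit_sum _ mf f1).
rewrite (Rintegral_partial_digit_sum _ mg g1).
set B := Rintegral _ _ _; set A := Rintegral _ _ _.
set B' := \sum_w _; set A' := \sum_w _ => hB hA.
have prodE : ((A' +i* B')%C : R[i]) = \prod_(i < m)
    ((\sum_(k : D) cexp2pi (- (xi%:R * ((val k)%:R / b%:R ^+ i.+1)))) * c%:C%C).
  (* Expanding the product of sums yields one term per word [w], with weight [c ^ m]. *)
  rewrite big_split/= prodr_const card_ord bigA_distr_bigA/= mulr_suml.
  have CE (x y : {ffun 'I_m -> D} -> R) :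
      ((\sum_w x w) +i* (\sum_w y w))%C = \sum_w (x w +i* y w)%C :> R[i].
    by elim/big_ind3 : _ => // x1 x2 x3 y1 y2 y3 <- <-.
  rewrite /A' /B' CE; apply: eq_bigr => w _.
  have -> : \prod_(i < m) cexp2pi (- (xi%:R * ((\val (w i))%:R / b%:R ^+ i.+1)))
     = cexp2pi (- (xi%:R * \sum_(i < m) (val (w i))%:R / b%:R ^+ i.+1)) :> R[i].
    rewrite mulr_sumr -sumrN.
    by apply/esym; apply: (big_morph _ cexp2piD cexp2pi0).
  rewrite -rmorphXn/= /f /g; case: (cexp2pi _) => x y.
  by apply/eqP; rewrite eq_complex/= !mulr0 subr0 add0r mulrC eqxx mulrC eqxx.
have -> : fourier nu xi%:Z = (A' +i* B')%C + ((A - A') +i* (B - B'))%C.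
  by apply/eqP; rewrite eq_complex/= !(addrC A') !(addrC B') !subrK !eqxx.
rewrite (le_trans (le_normcD _ _))// lerD//.
  rewrite prodE normc_prod ler_prod// => i _.
  by rewrite Normc.normcM normc_real ger0_norm// lexx q0.
by rewrite (le_trans (normc_le_add _ _))// mulr_natl mulr2n lerD.
Qed.

(** The approximation is used with [n + m] digits for large [m]: the error becomes arbitrarily
    small, and the extra factors are at most [1]. *)
Lemma normc_fourier_le (xi n : nat) :
  Normc.normc (fourier nu xi%:Z) <= \prod_(i < n) digit_factor xi i.
Proof.
have pi0 : 0 <= pi :> R := pi_ge0 R.
apply/ler_addgt0Pr => e e0.
(* The summand [1] keeps [L] positive for [xi = 0]. *)
pose L : R := 2 * (2 * pi * xi%:R) + 1.
have L0 : 0 < L by rewrite ltr_wpDl// !mulr_ge0.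
have [m mL] := expV_small b1 (divr_gt0 e0 L0).
have b0 : 0 < b%:R :> R by rewrite ltr0n ltnW.
rewrite (le_trans (fourier_approx xi (n + m)))// lerD//.
  rewrite big_split_ord/= ler_piMr ?prodr_ge0//.
  by apply: prodr_ile1 => i _; rewrite q0 q1.
have /ltW : b%:R ^- (n + m) < e / L.
  rewrite (le_lt_trans _ mL)// lef_pV2 ?posrE ?exprn_gt0//.
  by rewrite ler_weXn2l ?leq_addl// ler1n ltnW.
rewrite ler_pdivlMr// => h; rewrite (le_trans _ h)// mulrA mulrC ler_wpM2l//.
by rewrite lerDl.
Qed.

End random_digits.

(** * Fejer's kernel and the mass distribution principle *)

Section frostman.
Context {R : realType}.
Implicit Types (nu : probability R R) (x y c r : R).

(** For fixed [j], each distance is attained by at most two [k]. *)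
Lemma sum_dist_le (a : nat -> R) N j : (forall n, 0 <= a n) -> (j < N)%N ->
  \sum_(0 <= k < N) a `|j - k|%N <= 2 * \sum_(0 <= k < N) a k.
Proof.
move=> a0 jN; rewrite (@big_cat_nat _ _ _ j)//=; last exact: ltnW.
have sub m n : (n <= N)%N -> \sum_(m <= k < n) a k <= \sum_(0 <= k < N) a k.
  move=> nN; have [mn|nm] := leqP m n; last first.
    by rewrite big_geq ?sumr_ge0// ltnW.
  rewrite (@big_cat_nat _ _ _ n 0 N)//= (@big_cat_nat _ _ _ m 0 n)//=.
  by rewrite [X in _ <= X + _]addrC -addrA lerDl addr_ge0// sumr_ge0.
rewrite mulr_natl mulr2n lerD//.
  rewrite big_nat_rev/= add0n (eq_big_nat _ _ (F2 := fun k => a k.+1)).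
    by rewrite -(big_add1 _ _ 0 j.+1 xpredT) sub.
  by move=> k kj; congr a; lia.
rewrite -{1}[j]add0n big_addn (eq_big_nat _ _ (F2 := a)).
  by rewrite sub// leq_subr.
by move=> k kj; congr a; lia.
Qed.

(** Both sides are the squared modulus of an exponential sum, [N] times Fejer's kernel. The left
    side shows that it is nonnegative; the right side involves only cosines, whose integrals are
    controlled by Fourier coefficients. *)
Lemma fejer_expand N y :
  (\sum_(j < N) cos (2 * pi * (j%:R * y))) ^+ 2 +
  (\sum_(j < N) sin (2 * pi * (j%:R * y))) ^+ 2 =
  \sum_(j < N) \sum_(k < N) cos (2 * pi * (`|j - k|%N%:R * y)) :> R.
Proof.
rewrite !expr2 !big_distrlr/= -big_split/=; apply: eq_bigr => j _.
rewrite -big_split/=; apply: eq_bigr => k _.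
rewrite -cosB -mulrBr -mulrBl.
have [jk|/ltnW kj] := leqP k j; first by rewrite distnEl// natrB.
by rewrite distnEr// natrB// -cosN -mulrN -mulNr opprB.
Qed.

Lemma cos_ge_half y : `|y| <= 2^-1 -> 2^-1 <= cos y.
Proof.
by move=> y2; have := cos_lipschitz y 0; rewrite cos0 subr0 ler_norml; lra.
Qed.

(** For [j < N] the angle is at most [2 pi / 16] in absolute value, which [pi < 4] puts below
    [1 / 2]; so each cosine is at least [1 / 2], and the square of their sum suffices. *)
Lemma fejer_ge N y : `|y| * N%:R <= 16^-1 ->
  N%:R ^+ 2 / 4 <=
    \sum_(j < N) \sum_(k < N) cos (2 * pi * (`|j - k|%N%:R * y)) :> R.
Proof.
move=> yN; have hcos (j : 'I_N) : 2^-1 <= cos (2 * pi * (j%:R * y)).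
  apply: cos_ge_half; rewrite !normrM (ger0_norm (pi_ge0 R)) !normr_nat.
  have jN : j%:R * `|y| <= 16^-1.
    by rewrite (le_trans _ yN)// mulrC ler_wpM2l// ler_nat ltnW.
  have := pihalf_lt2 R; have := pi_gt0 R; have := normr_ge0 y.
  move: (pi : R) (j%:R : R) (ler0n R j) jN => p q q0 ? ? ? ?; nra.
rewrite -fejer_expand -[leLHS]addr0 lerD ?sqr_ge0//.
have -> : N%:R ^+ 2 / 4 = (N%:R / 2) ^+ 2 :> R by field.
rewrite ler_sqr ?nnegrE ?divr_ge0//; last first.
  by apply: sumr_ge0 => j _; rewrite (le_trans _ (hcos j)).
rewrite mulrC mulr_natr -[X in _ *+ X]card_ord -sumr_const ler_sum// => j _.
Qed.

Lemma measurable_cos_affine (n : R) c :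
  measurable_fun setT (fun x : R => cos (2 * pi * (n * (x - c)))).
Proof.
apply: continuous_measurable_fun => x.
apply: (@continuous_comp _ _ _ (fun x : R => 2 * pi * (n * (x - c))) cos).
  by apply: cvgM; [exact: cvg_cst|apply: cvgM; [exact: cvg_cst|apply: cvgB]];
    [exact: cvg_id|exact: cvg_cst].
exact: continuous_cos.
Qed.

Lemma measurable_sin_affine (n : R) c :
  measurable_fun setT (fun x : R => sin (2 * pi * (n * (x - c)))).
Proof.
apply: continuous_measurable_fun => x.
apply: (@continuous_comp _ _ _ (fun x : R => 2 * pi * (n * (x - c))) sin).
  by apply: cvgM; [exact: cvg_cst|apply: cvgM; [exact: cvg_cst|apply: cvgB]];
    [exact: cvg_id|exact: cvg_cst].
exact: continuous_sin.
Qed.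

(** Translation by [c] multiplies the coefficient by [cexp2pi (n c)], and the integral is the real
    part of that product. *)
Lemma Rintegral_cos_shift_le nu (n : nat) c :
  \int[nu]_(x in `[0, 1]) cos (2 * pi * (n%:R * (x - c))) <=
    Normc.normc (fourier nu n%:Z).
Proof.
pose f1 x : R := cos (2 * pi * - (n%:R * x)).
pose f2 x : R := sin (2 * pi * - (n%:R * x)).
have f1E : f1 = fun x => cos (2 * pi * (n%:R * (x - 0))).
  by apply/funext => x; rewrite /f1 mulrN cosN subr0.
have f2E : f2 = fun x => sin (2 * pi * (- n%:R * (x - 0))).
  by apply/funext => x; rewrite /f2 mulNr subr0.
have i1 : nu.-integrable `[0, 1] (EFin \o f1).
  apply: (@bounded_integrable _ _ _ _ _ _ 1) => // [|x]; last exact: cos_max.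
  by rewrite f1E; exact: measurable_cos_affine.
have i2 : nu.-integrable `[0, 1] (EFin \o f2).
  apply: (@bounded_integrable _ _ _ _ _ _ 1) => // [|x]; last exact: sin_max.
  by rewrite f2E; exact: measurable_sin_affine.
set p : R := 2 * pi * (n%:R * c).
rewrite (_ : Rintegral _ _ _ =
    cos p * complex.Re (fourier nu n) - sin p * complex.Im (fourier nu n)).
  set A := complex.Re _; set B := complex.Im _.
  have -> : fourier nu n = (A +i* B)%C by [].
  rewrite /Normc.normc; apply: le_trans (ler_norm _) _.
  rewrite -sqrtr_sqr ler_wsqrtr//.
  have := cos2Dsin2 p => h.
  (* The rotation by the angle [p] preserves the modulus. *)
  rewrite (_ : A ^+ 2 + B ^+ 2 =
      (cos p * A - sin p * B) ^+ 2 + (sin p * A + cos p * B) ^+ 2).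
    by rewrite lerDl sqr_ge0.
  by rewrite -[A ^+ 2 + _]mul1r -h; ring.
rewrite -[complex.Re _]/(\int[nu]_(x in `[0, 1]) f1 x).
rewrite -[complex.Im _]/(\int[nu]_(x in `[0, 1]) f2 x).
rewrite -!RintegralZl// -RintegralB//.
- apply: eq_Rintegral => x _; rewrite mulrBr mulrBr -/p cosB.
  by rewrite /f1 /f2 !mulrN cosN sinN; ring.
- exact: integrableZl i1.
- exact: integrableZl i2.
Qed.

Lemma probability_setI_full nu (A B : set R) : measurable A -> measurable B ->
  nu B = 1%E -> nu (A `&` B) = nu A.
Proof.
move=> mA mB nuB; rewrite [RHS](measureDI _ mA mB).
rewrite [X in (X + _)%E](_ : _ = 0%E) ?add0e//.
apply/eqP; rewrite -measure_le0 (@le_trans _ _ (nu (~` B)))//.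
  apply: le_measure; rewrite ?inE//; first exact: measurableD.
    exact: measurableC.
by rewrite [leLHS]probability_setC// nuB subee.
Qed.

(** The double sum [G] is nonnegative, at least [N ^+ 2 / 4] on the interval, and its integral is at
    most [2 N] times the sum of the moduli; comparing the two gives the constant [8]. *)
Lemma measure_ball_le nu c r N : nu `[0, 1]%classic = 1%E -> (0 < N)%N ->
  r * N%:R <= 16^-1 ->
  (nu `[(c - r)%R, (c + r)%R]%classic <=
    (8 / N%:R * \sum_(0 <= k < N) Normc.normc (fourier nu k%:Z))%:E)%E.
Proof.
move=> nu01 N0 rN; set I := `[c - r, c + r]%classic.
pose G x : R :=
  \sum_(j < N) \sum_(k < N) cos (2 * pi * (`|j - k|%N%:R * (x - c))).
have N0' : 0 < N%:R :> R by rewrite ltr0n.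
have mI : measurable I by exact: measurable_itv.
have ic (n : nat) : nu.-integrable `[0, 1]
    (EFin \o (fun x : R => cos (2 * pi * (n%:R * (x - c))))).
  apply: (@bounded_integrable _ _ _ _ _ _ 1) => // [|x]; last exact: cos_max.
  exact: measurable_cos_affine.
have ic2 j : nu.-integrable `[0, 1] (EFin \o (fun x : R =>
    \sum_(k < N) cos (2 * pi * (`|j - k|%N%:R * (x - c))))).
  rewrite (_ : _ \o _ = fun x => (\sum_(k < N)
      (cos (2 * pi * (`|j - k|%N%:R * (x - c))))%:E)%E).
    by apply: integrable_sum => // k _; exact: ic.
  by apply/funext => x /=; rewrite sumEFin.
have iG : nu.-integrable `[0, 1] (EFin \o G).
  rewrite (_ : _ \o _ = fun x => (\sum_(j < N)
      (\sum_(k < N) cos (2 * pi * (`|j - k|%N%:R * (x - c))))%:E)%E).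
    by apply: integrable_sum => // k _; exact: ic2.
  by apply/funext => x /=; rewrite sumEFin.
have G0 x : 0 <= G x by rewrite /G -fejer_expand addr_ge0 ?sqr_ge0.
have iI : nu.-integrable `[0, 1] (EFin \o (\1_I : R -> R)).
  apply: (@bounded_integrable _ _ _ _ _ _ 1) => // x; rewrite indicE.
  by case: (_ \in _); rewrite ?normr1 ?normr0.
have up : \int[nu]_(x in `[0, 1]) G x <=
    N%:R * (2 * \sum_(0 <= k < N) Normc.normc (fourier nu k%:Z)).
  rewrite /G Rintegral_sum//.
  rewrite (@le_trans _ _ (\sum_(j < N)
      (2 * \sum_(0 <= k < N) Normc.normc (fourier nu k%:Z))))//.
    apply: ler_sum => j _; rewrite Rintegral_sum//.
    pose ft k := Normc.normc (fourier nu k%:Z).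
    apply: le_trans (@sum_dist_le ft _ _ _ (ltn_ord j)).
      by rewrite big_mkord ler_sum// => k _; exact: Rintegral_cos_shift_le.
    by move=> ?; exact: normc_ge0.
  by rewrite sumr_const card_ord [leRHS]mulr_natl.
have low : N%:R ^+ 2 / 4 * fine (nu I) <= \int[nu]_(x in `[0, 1]) G x.
  have -> : fine (nu I) = \int[nu]_(x in `[0, 1]) \1_I x.
    rewrite /Rintegral integral_indic//; congr fine.
    exact/esym/probability_setI_full.
  rewrite -RintegralZl//; apply: le_Rintegral => //.
    exact: integrableZl iI.
  move=> x _; rewrite indicE; have [xI|xI] := boolP (x \in I); last first.
    by rewrite mulr0.
  rewrite mulr1; apply: fejer_ge; apply: le_trans rN.
  rewrite ler_wpM2r// ler_distl.
  by move: xI; rewrite /I inE/= in_itv.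
rewrite -[leLHS]fineK ?fin_num_measure// lee_fin.
have := le_trans low up.
move: (fine _) (\sum_(_ <= _ < _) _) => u S h.
rewrite mulrAC ler_pdivlMr//.
rewrite -(@ler_pM2l _ (N%:R / 4)) ?divr_gt0//.
by move: h; rewrite expr2; lra.
Qed.

Lemma diam_le_mem (A : set R) x y : A x -> A y -> (`|x - y|%:E <= diam A)%E.
Proof. by move=> Ax Ay; apply: ereal_sup_ubound; exists (x, y). Qed.

Lemma diam_pow_ge0 (s : R) (A : set R) : (0 <= diam_pow s A)%E.
Proof. by rewrite /diam_pow; case: ifPn => // _; exact: poweR_ge0. Qed.

(** Mass distribution principle: a covering set containing [c] lies in the interval around [c] whose
    radius is its diameter, so it carries mass at most [C diam ^ t], and every cover has weight at
    least [C^-1]. Radius [0] is included for the sake of one-point sets. *)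
Lemma hausdorff_measure_gt0 nu (A : set R) (t C : R) (delta : R) :
  measurable A -> nu A = 1%E -> 0 < C -> 0 < delta ->
  (forall c r, 0 <= r <= delta ->
    (nu `[(c - r)%R, (c + r)%R]%classic <= (C * r `^ t)%:E)%E) ->
  (0 < hausdorff_measure t A)%E.
Proof.
move=> mA nuA C0 d0 nuC.
apply: (@lt_le_trans _ _ (C^-1)%:E); first by rewrite lte_fin invr_gt0.
apply: (@le_trans _ _ (hausdorff_premeasure t delta A)); last first.
  by apply: ereal_sup_ubound; exists delta.
apply: le_ereal_inf_tmp => _ [U [AU Ud] <-].
have I i : exists I : set R, [/\ measurable I, U i `<=` I &
    (nu I <= C%:E * diam_pow t (U i))%E].
  rewrite /diam_pow; case: ifPn => [/eqP ->|/set0P[c Uc]].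
    by exists set0; split => //; rewrite measure0 mule0.
  have d0' : (0 <= diam (U i))%E.
    by rewrite (le_trans _ (diam_le_mem Uc Uc))// lee_fin.
  have dfin : diam (U i) \is a fin_num.
    by rewrite ge0_fin_numE// (le_lt_trans (Ud i))// ltry.
  exists `[c - fine (diam (U i)), c + fine (diam (U i))]%classic; split => //.
    move=> x Ux; rewrite /= in_itv/= -ler_distl -lee_fin fineK//.
    exact: diam_le_mem.
  rewrite (le_trans (nuC _ _ _))//; first by rewrite -!lee_fin fineK// d0' Ud.
  by rewrite -{2}(fineK dfin) poweR_EFin -EFinM.
have [J HJ] := choice I.
have h : (1 <= C%:E * \sum_(0 <= i <oo) diam_pow t (U i))%E.
  rewrite -nneseriesZl; last by move=> i _; exact: diam_pow_ge0.
  rewrite -nuA; apply: (@le_trans _ _ (\sum_(0 <= i <oo) nu (J i))%E).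
    apply: measure_sigma_subadditive => //.
    - by move=> i; have [] := HJ i.
    - move=> x /AU[i _ Ux]; exists i => //; have [_ + _] := HJ i; exact.
  by apply: lee_nneseries => // i _; have [] := HJ i.
by rewrite -[leLHS]mule1 lee_pdivrMl.
Qed.

Lemma kappa1_le_hausdorff_dim nu (A : set R) :
  measurable A -> A `<=` `[0, 1]%classic -> nu A = 1%E ->
  (kappa1 nu <= hausdorff_dim A)%E.
Proof.
move=> mA A01 nuA.
have nu01 : nu `[0, 1]%classic = 1%E.
  apply/eqP; rewrite eq_le probability_le1//= -nuA.
  by apply: le_measure; rewrite ?inE.
apply: ge_ereal_sup => _ [s [s0 [C HC]] <-].
apply: le_ereal_inf_tmp => _ [t [t0 Ht] <-].
rewrite lee_fin leNgt; apply/negP => ts.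
have C0 : 0 <= C.
  have := HC 1%N isT; rewrite powR1 mulr1; apply: le_trans.
  by rewrite sumr_ge0// => ? _; exact: normc_ge0.
(* The [8] comes from [measure_ball_le] and [32 ^ s] from [N >= 1 / (32 r')]; the maximum ensures
   positivity. *)
pose C1 : R := Num.max 1 (8 * C * 32 `^ s).
have C10 : 0 < C1 by rewrite lt_max ltr01.
suff : (0 < hausdorff_measure t A)%E by rewrite Ht ltxx.
apply: (@hausdorff_measure_gt0 nu A t C1 16^-1) => //.
(* The radius [r'] may exceed [r], so that the case [r = 0] can be settled by letting [r']
   shrink. *)
have key c r r' : 0 < r' <= 16^-1 -> r <= r' ->
    (nu `[(c - r)%R, (c + r)%R]%classic <= (C1 * r' `^ s)%:E)%E.
  move=> /andP[r'0 r'1] rr'.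
  (* The largest [N] with [r' N <= 1 / 16]; as [N + 1 <= 2 N], it is still at least
     [1 / (32 r')]. *)
  pose N := Num.truncn ((16 * r')^-1).
  have w0 : 0 <= (16 * r')^-1 by rewrite invr_ge0; lra.
  have /andP[N1 N2] := truncn_itv w0; rewrite -/N in N1 N2.
  have N0 : (0 < N)%N.
    rewrite -ltnS -(ltr_nat R) (le_lt_trans _ N2)// -[leLHS]invr1.
    by rewrite lef_pV2 ?posrE//; lra.
  have N0' : 0 < N%:R :> R by rewrite ltr0n.
  have NN : N.+1%:R <= 2 * N%:R :> R by rewrite -natrM ler_nat; lia.
  have r'N : (32 * r')^-1 <= N%:R.
    have -> : (32 * r')^-1 = (16 * r')^-1 / 2 by field; rewrite gt_eqF.
    by lra.
  have rN : r * N%:R <= 16^-1.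
    rewrite (@le_trans _ _ (r' * N%:R))// ?ler_wpM2r//.
    rewrite -(ler_pM2l r'0) in N1; apply: le_trans N1 _.
    by rewrite invfM mulrCA divff ?gt_eqF// mulr1.
  rewrite (le_trans (measure_ball_le c nu01 N0 rN))// lee_fin.
  apply: (@le_trans _ _ (8 / N%:R * (C * N%:R `^ (1 - s)))).
    rewrite ler_wpM2l ?divr_ge0// (le_trans _ (HC _ N0))//.
    by rewrite big_nat_recr// lerDl; exact: normc_ge0.
  have -> : N%:R `^ (1 - s) = N%:R / N%:R `^ s.
    by rewrite powRB ?powRr1// (gt_eqF N0') implybT.
  have -> : 8 / N%:R * (C * (N%:R / N%:R `^ s)) = 8 * C * (N%:R `^ s)^-1.
    by field; rewrite ?gt_eqF ?powR_gt0.
  apply: (@le_trans _ _ (8 * C * (32 * r') `^ s)).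
    rewrite ler_wpM2l ?mulr_ge0// -div1r ler_pdivrMr ?powR_gt0//.
    have r32 : 0 < 32 * r' by lra.
    rewrite -powRM ?(ltW r32) ?(ltW N0')//.
    apply: (@le_trans _ _ (1 `^ s)); first by rewrite powR1.
    apply: ge0_ler_powR; rewrite ?nnegrE ?mulr_ge0 ?(ltW r'0)//.
    by rewrite mulrC -ler_pdivrMr// div1r.
  rewrite powRM//; last by lra.
  by rewrite mulrA ler_wpM2r ?powR_ge0// le_max lexx orbT.
move=> c r /andP[r0 r1]; have s0' : 0 < s by rewrite (le_lt_trans t0).
have [r00|r00] := eqVneq r 0; last first.
  have rp : 0 < r by rewrite lt_neqAle eq_sym r00.
  rewrite (le_trans (key c r r _ (lexx _))) ?rp ?r1// lee_fin ler_wpM2l//.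
    exact: ltW.
  (* From [r <= 1] and [t < s] follows [r ^ s <= r ^ t]. *)
  by apply: ger_powR; [lra|exact: ltW].
apply: (@le_trans _ _ 0%E); last by rewrite lee_fin mulr_ge0 ?powR_ge0 ?ltW.
apply/lee_addgt0Pr => e e0; rewrite add0e.
(* Small enough that [C1 r' ^ s <= e]; hence points have mass zero. *)
pose r' := Num.min 16^-1 ((e / C1) `^ s^-1).
have r'0 : 0 < r' by rewrite lt_min powR_gt0 ?divr_gt0// invr_gt0 ltr0n.
have r'1 : r' <= 16^-1 by rewrite ge_min lexx.
have kr : (nu `[(c - r)%R, (c + r)%R]%classic <= (C1 * r' `^ s)%:E)%E.
  by apply: key; rewrite ?r'0 ?r'1// r00 ltW.
rewrite (le_trans kr)// lee_fin.
rewrite mulrC -ler_pdivlMr//.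
have -> : e / C1 = ((e / C1) `^ s^-1) `^ s.
  by rewrite -powRrM mulVf ?gt_eqF// powRr1// divr_ge0 ?ltW.
apply: ge0_ler_powR; rewrite ?nnegrE ?powR_ge0 ?(ltW r'0) ?(ltW s0')//.
by rewrite ge_min lexx orbT.
Qed.

End frostman.

(** * Covers by cylinders and the upper bound on the dimension *)

Section dimension_upper_bound.
Context {R : realType}.
Variables (b : nat) (D : {fset nat}).
Hypotheses (b1 : (1 < b)%N) (Db : [set` D] `<=` `I_b) (D0 : (0 < #|` D|)%N).

Definition cylinder n (w : {ffun 'I_n -> D}) : set R :=
  [set x | exists u : nat -> nat, [/\ forall i, u i \in D,
    forall i : 'I_n, u i = val (w i) & x = digit_sum b u]].

Lemma diam_cylinder_le n (w : {ffun 'I_n -> D}) :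
  (diam (cylinder w) <= (b%:R ^- n)%:E)%E.
Proof.
apply: ge_ereal_sup => _ [[x y] /= [[u [uD uw ->]] [v [vD vw ->]]] <-].
rewrite lee_fin; apply: digit_sum_dist => // [i|i|i ni].
- exact: Db (uD i).
- exact: Db (vD i).
- by rewrite (uw (Ordinal ni)) (vw (Ordinal ni)).
Qed.

Lemma diam_pow_le (s e : R) (A : set R) : 0 <= s -> 0 <= e ->
  (diam A <= e%:E)%E -> (diam_pow s A <= (e `^ s)%:E)%E.
Proof.
move=> s0 e0 Ae; rewrite /diam_pow; case: ifPn => [_|/set0P[x Ax]].
  by rewrite lee_fin powR_ge0.
have A0 : (0 <= diam A)%E.
  by rewrite (le_trans _ (diam_le_mem Ax Ax))// lee_fin.
by rewrite -poweR_EFin gt0_ler_poweR// in_itv/= ?A0 ?lee_fin ?e0 leey.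
Qed.

Lemma hausdorff_premeasure_missing_digit_set_le (s delta : R) n : 0 <= s ->
  b%:R ^- n <= delta ->
  (hausdorff_premeasure s delta (missing_digit_set b D) <=
    ((#|` D| ^ n)%:R * (b%:R ^- n) `^ s)%:E)%E.
Proof.
move=> s0 nd; set x : R := b%:R ^- n.
have x0 : 0 <= x by rewrite invr_ge0 exprn_ge0.
pose W := {ffun 'I_n -> D}.
(* The finite family of cylinders is padded to a sequence by empty sets, to which [diam_pow] gives
   weight [0]. *)
pose U (i : nat) : set R :=
  if insub i is Some j then cylinder (enum_val (j : 'I_#|W|)) else set0.
have Ux i : (diam (U i) <= x%:E)%E.
  rewrite /U; case: insub => [j|]; first exact: diam_cylinder_le.
  by rewrite /diam setX0 image_set0 ereal_sup0 leNye.
apply: ge_ereal_inf; exists (\sum_(0 <= i <oo) diam_pow s (U i))%E.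
  exists U => //; split => [y|i]; last first.
    by rewrite (le_trans (Ux i))// lee_fin.
  move=> [_ [u [uD ->]]].
  pose w : W := [ffun i : 'I_n => FSetSub (uD i)].
  exists (val (enum_rank w)) => //; rewrite /U valK enum_rankK.
  by exists u; split => // i; rewrite ffunE.
rewrite (nneseries_split 0 #|W|); last by move=> i _; exact: diam_pow_ge0.
rewrite [X in (_ + X)%E]eseries0 ?adde0; last first.
  move=> i Wi _; rewrite /U insubF; last by rewrite ltnNge Wi.
  by rewrite /diam_pow eqxx.
apply: (@le_trans _ _ (\sum_(0 <= i < 0 + #|W|) (x `^ s)%:E)%E).
  by apply: lee_sum => i _; exact: diam_pow_le.
rewrite sumEFin sumr_const_nat subn0 add0n lee_fin.
by rewrite -[leLHS]mulr_natl card_ffun card_ord cardfE.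
Qed.

(** Since [b ^ s0 = l], the level-[n] cover has weight [l ^ n b ^ (- n (s0 + e)) = b ^ (- n e)] at
    exponent [s0 + e], which tends to [0] for every [e > 0]. *)
Lemma hausdorff_dim_missing_digit_set_le :
  (hausdorff_dim (missing_digit_set b D : set R) <=
    (ln #|` D|%fset%:R / ln b%:R)%:E)%E.
Proof.
have lR : 1 <= #|` D|%fset%:R :> R by rewrite ler1n.
have bR : 1 < b%:R :> R by rewrite ltr1n.
have b0 : 0 < b%:R :> R by rewrite (lt_trans _ bR).
set l : R := #|` D|%fset%:R in lR *; set s0 := _ / _.
have lnb : 0 < ln b%:R :> R by exact: ln_gt0.
have s00 : 0 <= s0 by rewrite divr_ge0 ?ln_ge0// ltW.
have bs0 : b%:R `^ s0 = l.
  by rewrite /powR gt_eqF// divfK ?gt_eqF// lnK// posrE (lt_le_trans _ lR).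
have nonneg (s delta : R) (A : set R) : (0 <= hausdorff_premeasure s delta A)%E.
  apply: le_ereal_inf_tmp => _ [U _ <-]; apply: nneseries_ge0 => i _ _.
  exact: diam_pow_ge0.
apply/lee_addgt0Pr => e e0; rewrite -EFinD.
have se : 0 <= s0 + e by rewrite addr_ge0// ltW.
apply: ereal_inf_lbound; exists (s0 + e) => //; split => //.
apply/eqP; rewrite eq_le; apply/andP; split; last first.
  apply: le_trans (nonneg (s0 + e) 1 (missing_digit_set b D)) _.
  by apply: ereal_sup_ubound; exists 1 => //=.
apply: ge_ereal_sup => _ [delta /= d0 <-].
apply/lee_addgt0Pr => eps eps0; rewrite add0e.
(* A mesh below [eps ^ (1 / e)] makes the weight at most [eps]. *)
have m0 : 0 < Num.min delta (eps `^ e^-1) by rewrite lt_min d0 powR_gt0.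
have [n] := expV_small b1 m0; rewrite lt_min => /andP[/ltW nd /ltW ne].
rewrite (le_trans (hausdorff_premeasure_missing_digit_set_le se nd))// lee_fin.
have x0 : 0 < b%:R ^- n :> R by rewrite invr_gt0 exprn_gt0.
have xs0 : (b%:R ^- n) `^ s0 = l ^- n :> R.
  by rewrite -(powR_invn _ (ltW b0)) powRAC bs0 powR_invn// (le_trans _ lR).
rewrite powRD ?(gt_eqF x0) ?implybT// xs0 natrX mulrA divff ?mul1r; last first.
  by rewrite expf_neq0// gt_eqF// (lt_le_trans _ lR).
have -> : eps = (eps `^ e^-1) `^ e.
  by rewrite -powRrM mulVf ?gt_eqF// powRr1 ?ltW.
by apply: ge0_ler_powR; rewrite ?nnegrE ?powR_ge0 ?(ltW x0) ?(ltW e0).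
Qed.

End dimension_upper_bound.

(** * Digits in arithmetic progression *)

Section arithmetic_digits.
Context {R : realType}.
Variables (a d l : nat).
Hypothesis d0 : (0 < d)%N.

Lemma perm_arith_digits :
  perm_eq (arith_digits a d l) [seq (k * d + a)%N | k <- iota 0 l].
Proof.
apply: uniq_perm; first exact: fset_uniq.
  rewrite map_inj_in_uniq ?iota_uniq// => i j _ _ /eqP.
  by rewrite eqn_add2r eqn_pmul2r// => /eqP.
move=> x; apply/imfsetP/mapP => /= -[k kl ->]; by exists k.
Qed.

Lemma card_arith_digits : #|` arith_digits a d l|%fset = l.
Proof.
by rewrite (perm_size perm_arith_digits) size_map size_iota.
Qed.

(** The offset [a] contributes a unimodular factor, and the sign of the frequency is absorbed by the
    evenness of the kernel. *)
Lemma normc_sum_arith_digits (y : R) :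
  Normc.normc (\sum_(k : arith_digits a d l) cexp2pi (- (y * (val k)%:R))) =
    dirichlet l (d%:R * y).
Proof.
rewrite -(big_seq_fsetE _ _ xpredT (fun k => cexp2pi (- (y * k%:R))))/=.
rewrite (perm_big _ perm_arith_digits) big_map -{1}[l]subn0 big_mkord.
rewrite -dirichletN /dirichlet.
rewrite (eq_bigr (fun k : 'I_l =>
    cexp2pi (- (y * a%:R)) * cexp2pi (k%:R * - (d%:R * y)))).
  by rewrite -mulr_sumr Normc.normcM normc_cexp2pi mul1r.
by move=> k _; rewrite -cexp2piD natrD natrM; congr cexp2pi; ring.
Qed.

End arithmetic_digits.

(** * Growth of the sums of Fourier coefficients *)

Section fourier_decay.
Context {R : realType} {disp : measure_display} {T : measurableType disp}.
Variables (P : probability T R) (b a d l : nat) (X : nat -> {RV P >-> nat}).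
Hypotheses (b1 : (1 < b)%N) (d0 : (0 < d)%N) (l1 : (1 < l)%N).
Hypothesis Db : [set` arith_digits a d l] `<=` `I_b.
Hypotheses (X_uniform : forall i, uniform_on (arith_digits a d l) (X i)).
Hypothesis X_indep : mutually_independent X.

Let nu := missing_digit_measure b X.

(** Read off from the largest digit [(l - 1) d + a]. *)
Let dlb : (d * l.-1 < b)%N.
Proof.
suff /Db/= : [set` arith_digits a d l] (l.-1 * d + a)%N by rewrite /= => h; lia.
apply/imfsetP; exists l.-1 => //=; rewrite mem_iota/=; lia.
Qed.

Let lb : (l <= b)%N. Proof. by have := dlb; nia. Qed.

Lemma normc_fourier_dirichlet_le (xi n : nat) :
  Normc.normc (fourier nu xi%:Z) <=
    \prod_(i < n) (dirichlet l (d%:R * (xi%:R / b%:R ^+ i.+1)) / l%:R).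
Proof.
apply: le_trans (normc_fourier_le b1 Db X_uniform X_indep xi n) _.
apply: ler_prod => i _; rewrite /digit_factor card_arith_digits//.
rewrite mulr_ge0 ?normc_ge0//=.
rewrite ler_wpM2r// -(normc_sum_arith_digits a)//.
rewrite le_eqVlt; apply/orP; left; apply/eqP; congr Normc.normc.
by apply: eq_bigr => k _; rewrite [X in xi%:R * X]mulrC mulrA.
Qed.

Lemma fourier_sum_le n :
  \sum_(0 <= xi < b ^ n) Normc.normc (fourier nu xi%:Z) <=
    (b%:R * (4 + ln (2 * l%:R)) / l%:R) ^+ n.
Proof.
apply: le_trans (@prod_dirichlet_sum_le R l b d n l1 d0 dlb).
by rewrite ler_sum_nat// => xi _; exact: normc_fourier_dirichlet_le.
Qed.

(** The exponent [s] is the one with [b ^ (1 - s) = b L / l], the growth rate found for the sums up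
    to [b ^ n]. For [b ^ (n - 1) <= Q < b ^ n] the sum is thus at most [(b ^ (1 - s)) ^ n <= b ^ (1
    - s) Q ^ (1 - s)]. *)
Lemma kappa1_ge :
  ((ln l%:R / ln b%:R - ln (4 + ln (2 * l%:R)) / ln b%:R)%:E <= kappa1 nu)%E.
Proof.
set L := 4 + _; set s := _ - _.
have b1' : 1 < b%:R :> R by rewrite ltr1n.
have b0 : 0 < b%:R :> R by rewrite (lt_trans _ b1').
have l0 : 0 < l%:R :> R by rewrite ltr0n ltnW.
have lnb : 0 < ln b%:R :> R by exact: ln_gt0.
have L4 : 4 <= L by rewrite lerDl ln_ge0// -natrM ler1n; lia.
have L0 : 0 < L by rewrite (lt_le_trans _ L4).
have powb : b%:R `^ (1 - s) = b%:R * L / l%:R.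
  rewrite /powR gt_eqF// (_ : (1 - s) * ln b%:R = ln (b%:R * L / l%:R)).
    by rewrite lnK// posrE divr_gt0// mulr_gt0.
  rewrite ln_div ?posrE ?mulr_gt0// lnM ?posrE// /s.
  rewrite mulrBl mul1r mulrBl !divfK ?gt_eqF//.
  by ring.
(* A negative [s] is not admissible in [kappa1], but [0] is: the coefficients are at most [1] in
   modulus, and [Q + 1 <= 2 Q]. *)
have [s0|s0] := leP 0 s; last first.
  apply: (@le_trans _ _ 0%E); first by rewrite lee_fin ltW.
  apply: ereal_sup_ubound; exists 0 => //; split => //; exists 2 => Q Q1.
  rewrite subr0 powRr1//.
  apply: (@le_trans _ _ (\sum_(0 <= xi < Q.+1) 1)).
    apply: ler_sum => xi _.
    by rewrite (le_trans (normc_fourier_dirichlet_le xi 0))// big_ord0.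
  by rewrite sumr_const_nat subn0 -natrM ler_nat; lia.
(* Makes the power with exponent [1 - s] monotone in the last step; it rests on [l <= b] and
   [L >= 1]. *)
have s1 : 0 <= 1 - s.
  have : ln l%:R <= ln b%:R :> R by rewrite ler_ln ?posrE// ler_nat.
  have : 0 <= ln L by rewrite ln_ge0//; lra.
  rewrite subr_ge0 /s -mulrBl ler_pdivrMr// mul1r => *; lra.
apply: ereal_sup_ubound; exists s => //; split => //.
exists (b%:R `^ (1 - s)) => Q Q1.
pose n := (trunc_log b Q).+1.
have Qn : (Q < b ^ n)%N by exact: trunc_log_ltn.
apply: (@le_trans _ _ (\sum_(0 <= xi < b ^ n) Normc.normc (fourier nu xi%:Z))).
  rewrite [leRHS](@big_cat_nat _ _ _ Q.+1)//= lerDl sumr_ge0//.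
apply: le_trans (fourier_sum_le n) _; rewrite -powb.
rewrite -powR_mulrn ?powR_ge0// powRAC powR_mulrn ?(ltW b0)//.
rewrite -powRM ?(ltW b0)//.
apply: ge0_ler_powR; rewrite ?nnegrE ?exprn_ge0 ?mulr_ge0 ?(ltW b0)//.
by rewrite exprS ler_wpM2l ?(ltW b0)// -natrX ler_nat trunc_logP.
Qed.

End fourier_decay.

Theorem theorem2p6 (R : realType) (b a d l : nat)
    (hb : (3 <= b)%N) (hd : (1 <= d)%N) (hl : (2 <= l)%N)
    (hD : [set` arith_digits a d l] `<` `I_b)
    (disp : measure_display) (T : measurableType disp) (P : probability T R)
    (X : nat -> {RV P >-> nat})
    (X_uniform : forall i, uniform_on (arith_digits a d l) (X i))
    (X_indep : mutually_independent X) :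
  let nu := missing_digit_measure b X in
  (dimH nu >= kappa1 nu)%E /\
  (kappa1 nu >= dimH nu - (ln (4 + ln (2 * l%:R)) / ln b%:R)%:E)%E.
Proof.
move=> nu; have b1 : (1 < b)%N by exact: ltnW.
have Db := properW hD.
have supp : msupport nu = missing_digit_set b (arith_digits a d l).
  exact: msupport_missing_digit_measure.
rewrite /dimH supp; split.
  apply: kappa1_le_hausdorff_dim.
  - apply: closed_measurable; apply: compact_closed; first exact: Rhausdorff.
    exact: compact_missing_digit_set.
  - by move=> x [x01 _]; rewrite /= in_itv.
  - exact: missing_digit_measure_full.
(* The lower bound for [kappa1] is in terms of [ln l / ln b], which dominates the dimension. *)
apply: le_trans (kappa1_ge b1 hd hl Db X_uniform X_indep).
rewrite EFinB; apply: leeB => //.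
rewrite -[X in (ln X%:R / _)%:E](card_arith_digits a l hd).
apply: hausdorff_dim_missing_digit_set_le => //.
by rewrite card_arith_digits// ltnW.
Qed.
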